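(* Let $k$ be a perfect field of characteristic two with $\mathbb{F}_4\subseteq k$, and let $s\in k$ be such that $x^3+s$ is irreducible in $k[x]$. Let $\mathcal{N}=\big((k\times k\times k)\setminus\{(0,0,0)\}\big)\times(k/\mathrm{AS}(k))$, and for $(a,b,c,d)\in\mathcal{N}$ let $C^s_{abcd}$ be the smooth projective curve of genus two over $k$ with quasi-affine model $y^2+y=\frac{ax^2+bx+c}{x^3+s}+d$. Then: 1. For any $(a,b,c,d),(a',b',c',d')\in\mathcal{N}$, the curves $C^s_{a'b'c'd'}$ and $C^s_{abcd}$ are $k$-isomorphic if and only if $(a',b',c',d')=(\epsilon^2a,\epsilon b,c,d)$ for some $\epsilon\in\mu_3$. 2. For any $(a,b,c,d)\in\mathcal{N}$ there is a split exact sequence $$1\to\langle\iota\rangle\to\mathrm{Aut}_k(C^s_{abcd})\to\Gamma_{abcd}\to1,$$ where $\Gamma_{abcd}$ is the isotropy group of $(a,b,c,d)$ under the action of $\Gamma=\{\epsilon x : \epsilon\in\mu_3\}$ on $\mathcal{N}$ given by $(a,b,c,d)^{\epsilon x}=(\epsilon^2a,\epsilon b,c,d)$, and $\Gamma_{abcd}\simeq C_3$ if $a=b=0$, while $\Gamma_{abcd}$ is trivial otherwise.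
   Context: $\mu_3$ is the group of cube roots of unity (contained in $k$ since $\mathbb{F}_4\subseteq k$). $\mathrm{AS}(k)=\{x+x^2 : x\in k\}$. The fourth coordinate $d$ of an element of $\mathcal{N}$ is a class in $k/\mathrm{AS}(k)$; in the equation of the curve one uses any representative in $k$, which does not change the $k$-isomorphism class, and comparisons of fourth coordinates are in $k/\mathrm{AS}(k)$. The hyperelliptic involution is $\iota\colon(x,y)\mapsto(x,y+1)$. Every $k$-automorphism of such a curve has the form $(x,y)\mapsto(\gamma(x),y+v(x))$ with $\gamma\in\mathrm{PGL}_2(k)$ a fractional linear transformation, $v(x)\in k(x)$, and the right-hand map of the exact sequence sends it to $\gamma$. $C_3$ denotes the cyclic group of order 3. *)

(* Defs.v *)
From HB Require Import structures.
From mathcomp Require Import all_boot all_order all_algebra all_field.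
From mathcomp Require Import monoid ring_quotient qpoly qfpoly ring boolp.

Set Implicit Arguments.
Unset Strict Implicit.
Unset Printing Implicit Defensive.

Import GRing.Theory.
Local Open Scope ring_scope.
Local Open Scope quotient_scope.

Local Notation "x %:F" := (@FracField.tofrac _ x).

Definition perfect_field (k : fieldType) : Prop :=
  forall p : nat, p \in [pchar k] -> forall x : k, exists y : k, y ^+ p = x.

Definition contains_F4 (k : fieldType) : Prop :=
  exists (F : finFieldType) (i : {rmorphism F -> k}), #|F| = 4%N.

(* A smooth projective curve over a perfect field k, with function field F, is
   represented as a locally ringed space by the Zariski-Riemann space of F over k:
   its points are the valuation rings of F containing k, that is, the local rings
   O_P of the curve, F itself being the local ring at the generic point.
   The sets {P | f in O_P} generate the Zariski topology (the cofinite topology on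
   closed points), and the regular functions on an open set U are those f in F
   lying in O_P for all P in U. *)

Record field_over (k : fieldType) := FieldOver {
  field_sort :> fieldType;
  cst : {rmorphism k -> field_sort}
}.

Section Curve.
Variable k : fieldType.
Implicit Types F : field_over k.

Record point F := Point {
  local_ring : F -> Prop;
  local_ring_cst : forall c : k, local_ring (cst F c);
  local_ringB : forall f g, local_ring f -> local_ring g -> local_ring (f - g);
  local_ringM : forall f g, local_ring f -> local_ring g -> local_ring (f * g);
  local_ringV : forall f, local_ring f \/ local_ring f^-1
}.

(* A k-isomorphism from the curve with function field F to the curve with
   function field F': a bijection pt on points and a k-isomorphism pull on
   functions, such that f is regular at pt P iff pull f is regular at P.
   The last condition makes pt a homeomorphism. *)
Record curve_iso F F' := CurveIso {
  pt : point F -> point F';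
  ptV : point F' -> point F;
  pull : F' -> F;
  pullV : F -> F';
  ptK : cancel pt ptV;
  ptVK : cancel ptV pt;
  pullK : cancel pull pullV;
  pullVK : cancel pullV pull;
  pullD : {morph pull : f g / f + g};
  pullM : {morph pull : f g / f * g};
  pull_cst : forall c : k, pull (cst F' c) = cst F c;
  pull_local : forall P f, local_ring (pt P) f <-> local_ring P (pull f)
}.

Definition k_isomorphic F F' : Prop := inhabited (curve_iso F F').

Lemma curve_iso_eq F F' (u v : curve_iso F F') :
  pt u =1 pt v -> pull u =1 pull v -> u = v.
Proof.
case: u => p p' q q' a1 a2 a3 a4 a5 a6 a7 a8.
case: v => r r' t t' b1 b2 b3 b4 b5 b6 b7 b8 /= /funext epr /funext eqt.
subst r t.
have epr' : p' = r' by apply: funext => x; rewrite -{1}(b2 x) a1.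
have eqt' : q' = t' by apply: funext => x; rewrite -{1}(b4 x) a3.
by subst r' t'; f_equal; apply: Prop_irrelevance.
Qed.

Definition curve_id F : curve_iso F F :=
  @CurveIso F F id id id id (frefl _) (frefl _) (frefl _) (frefl _)
    (fun _ _ => erefl) (fun _ _ => erefl) (fun _ => erefl)
    (fun _ _ => iff_refl _).

Section Composition.
Variables (F F' F'' : field_over k).
Variables (u : curve_iso F' F'') (v : curve_iso F F').

Lemma comp_pullD : {morph pull v \o pull u : f g / f + g}.
Proof. by move=> f g /=; rewrite !pullD. Qed.
Lemma comp_pullM : {morph pull v \o pull u : f g / f * g}.
Proof. by move=> f g /=; rewrite !pullM. Qed.
Lemma comp_pull_cst c : (pull v \o pull u) (cst F'' c) = cst F c.
Proof. by rewrite /= !pull_cst. Qed.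
Lemma comp_pull_local P f :
  local_ring ((pt u \o pt v) P) f <-> local_ring P ((pull v \o pull u) f).
Proof. by rewrite /= !pull_local. Qed.

Definition curve_comp : curve_iso F F'' :=
  CurveIso (can_comp (ptK u) (ptK v)) (can_comp (ptVK v) (ptVK u))
    (can_comp (pullK v) (pullK u)) (can_comp (pullVK u) (pullVK v))
    comp_pullD comp_pullM comp_pull_cst comp_pull_local.

End Composition.

Section Inverse.
Variables (F F' : field_over k) (u : curve_iso F F').

Fact pullVD : {morph pullV u : f g / f + g}.
Proof. by move=> f g; apply: (can_inj (pullK u)); rewrite pullD !pullVK. Qed.
Lemma pullVM : {morph pullV u : f g / f * g}.
Proof. by move=> f g; apply: (can_inj (pullK u)); rewrite pullM !pullVK. Qed.
Lemma pullV_cst c : pullV u (cst F c) = cst F' c.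
Proof. by rewrite -(pull_cst u) pullK. Qed.
Lemma pullV_local P f : local_ring (ptV u P) f <-> local_ring P (pullV u f).
Proof. by rewrite -{2}(ptVK u P) pull_local pullVK. Qed.

Definition curve_inv : curve_iso F' F :=
  CurveIso (ptVK u) (ptK u) (pullVK u) (pullK u)
    pullVD pullVM pullV_cst pullV_local.

End Inverse.

Definition curve_aut F : Type := curve_iso F F.

HB.instance Definition _ F := gen_eqMixin (curve_aut F).
HB.instance Definition _ F := gen_choiceMixin (curve_aut F).

Section Group.
Variable F : field_over k.

Let mul (u v : curve_aut F) : curve_aut F := curve_comp u v.
Let one : curve_aut F := curve_id F.
Let inv (u : curve_aut F) : curve_aut F := curve_inv u.

Lemma curve_compA : associative mul.
Proof. by move=> u v w; apply: curve_iso_eq. Qed.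
Lemma curve_comp1l : left_id one mul.
Proof. by move=> u; apply: curve_iso_eq. Qed.
Lemma curve_comp1r : right_id one mul.
Proof. by move=> u; apply: curve_iso_eq. Qed.
Lemma curve_compVl : left_inverse one inv mul.
Proof. by move=> u; apply: curve_iso_eq => x /=; rewrite ?ptK ?pullVK. Qed.
Lemma curve_compVr : right_inverse one inv mul.
Proof. by move=> u; apply: curve_iso_eq => x /=; rewrite ?ptVK ?pullK. Qed.

HB.instance Definition _ := isGroup.Build (curve_aut F)
  curve_compA curve_comp1l curve_comp1r curve_compVl curve_compVr.

End Group.
End Curve.

Section Equation.

Lemma AS_size (L : fieldType) (r : L) : size ('X^2 + 'X - r%:P) = 3%N.
Proof. by rewrite -addrA size_polyDl size_polyXn // -polyCN size_XaddC. Qed.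

Lemma AS_monic (L : fieldType) (r : L) : 'X^2 + 'X - r%:P \is monic.
Proof.
by rewrite monicE /lead_coef AS_size /= !coefE /= addr0 subr0.
Qed.

Lemma AS_clear (L : fieldType) (p m h q d : L) : m != 0 -> h != 0 ->
  (p / m) ^+ 2 + p / m = q / h + d ->
  h * (p ^+ 2 + p * m) = (q + d * h) * m ^+ 2.
Proof.
move=> m0 h0 E.
have -> : q + d * h = (q / h + d) * h by field.
by rewrite -E; field.
Qed.

Variables (k : fieldType) (s : k).

Definition ratfun := {fraction {poly k}}.

Definition AS_rhs (v : k * k * k) (d : k) : ratfun :=
  let: (a, b, c) := v in
  (a *: 'X^2 + b *: 'X + c%:P)%:F / ('X^3 + s%:P)%:F + d%:P%:F.

Definition AS_poly (v : k * k * k) (d : k) : {poly ratfun} :=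
  'X^2 + 'X - (AS_rhs v d)%:P.


Lemma ratfun_coprime (z : ratfun) : exists p q : {poly k},
  [/\ q != 0, coprimep p q & z = p%:F / q%:F].
Proof.
pose r : {ratio {poly k}} := repr z; pose n := (frac r).1; pose m := (frac r).2.
have m0 : m != 0 by exact: denom_ratioP.
have zE : z = n%:F / m%:F.
  apply: (canRL (mulfK _)); first by rewrite tofrac_eq0.
  rewrite -[z]reprK -/r; unlock FracField.tofrac.
  rewrite -[LHS](FracField.pi_mul r); apply/eqP; rewrite piE.
  rewrite FracField.equivfE /FracField.mulf.
  by rewrite !numden_Ratio ?mulr1 ?mulf_neq0 ?oner_neq0 // mulrC.
pose g := gcdp n m.
have g0 : g != 0 by rewrite gcdp_eq0 negb_and m0 orbT.
have gE p : g %| p -> p%:F = (p %/ g)%:F * g%:F.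
  by move=> gp; rewrite -tofracM divpK.
exists (n %/ g), (m %/ g); split.
- by rewrite dvdp_div_eq0 ?dvdp_gcdr.
- by apply: coprimep_div_gcd; rewrite m0 orbT.
rewrite zE (gE n) ?dvdp_gcdl // (gE m) ?dvdp_gcdr // -mulf_div divff ?mulr1 //.
by rewrite tofrac_eq0.
Qed.

Lemma AS_poly_irreducible (v : k * k * k) (d : k) :
  irreducible_poly ('X^3 + s%:P) -> v != (0, 0, 0) ->
  monic_irreducible_poly (AS_poly v d).
Proof.
set h := 'X^3 + s%:P => hirr v0.
have szh : size h = 4%N.
  by rewrite size_polyDl size_polyXn // size_polyC; case: eqP.
have h0 : h != 0 by rewrite -size_poly_eq0 szh.
split; last exact: AS_monic.
apply: cubic_irreducible => [|z]; first by rewrite AS_size.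
apply/negP; rewrite rootE /AS_poly !hornerE.
have [p [m [m0 cpm ->]]] := ratfun_coprime z.
case: v v0 => [[a b] c] v0; rewrite /AS_rhs -/h; set q := a *: _ + _ + _.
have q0 : q != 0.
  apply: contra v0 => /eqP qE; apply/eqP.
  move: (congr1 (fun t : {poly k} => (t`_2, t`_1, t`_0)) qE).
  by rewrite /q !coefE /= !(mulr0, mulr1, addr0, add0r).
have szq : (size q < size h)%N.
  rewrite szh ltnS; apply/leq_sizeP => j lej; rewrite /q !coefE.
  by case: j lej => [|[|[|j]]] //= _; rewrite !mulr0 !addr0.
rewrite subr_eq0 => /eqP /AS_clear; rewrite !tofrac_eq0 => /(_ m0 h0).
rewrite -!(tofracXn, tofracM, tofracD) => /eqP; rewrite tofrac_eq => /eqP E.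
have cqh : coprimep h q.
  rewrite irreducible_poly_coprime //; apply/negP => /(dvdp_leq q0).
  by rewrite leqNgt szq.
have hm : h %| m.
  have : h %| q * m ^+ 2.
    rewrite (_ : q * m ^+ 2 = h * (p ^+ 2 + p * m - d%:P * m ^+ 2)).
      exact: dvdp_mulr.
    by rewrite mulrBr E; ring.
  rewrite Gauss_dvdpr // expr2; have := irreducible_poly_coprime m hirr.
  by case: (h %| m) => //= chm; rewrite Gauss_dvdpr // -[m]mulr1 Gauss_dvdpr //
    dvdp1 szh.
have hp : h %| p ^+ 2.
  rewrite -(@dvdp_mul2l _ h) //.
  have -> : h * p ^+ 2 = (q + d%:P * h) * m ^+ 2 - h * p * m.
    by rewrite -E; ring.
  apply: dvdp_sub; first by rewrite dvdp_mull // expr2 dvdp_mul.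
  by rewrite mulrAC dvdp_mulr // dvdp_mul.
have chp : coprimep h p by rewrite coprimep_sym (coprimep_dvdl hm).
by move: hp; rewrite -[p ^+ 2]mulr1 Gauss_dvdpr ?coprimep_expr // dvdp1 szh.
Qed.
End Equation.

Section FunctionField.
Variables (k : fieldType) (s : k).
Hypothesis s_irr : irreducible_poly ('X^3 + s%:P).

Definition coefs := {v : k * k * k | v != (0, 0, 0)}.

Variables (v : coefs) (d : k).

Let irr := AS_poly_irreducible d s_irr (valP v).

Definition AS_field : fieldType := {poly %/ AS_poly s (val v) d with irr}.

Definition AS_ratfun : {rmorphism ratfun k -> AS_field} :=
  @qpolyC _ (AS_poly s (val v) d).

Definition AS_cst : {rmorphism k -> AS_field} :=
  AS_ratfun \o (@FracField.tofrac {poly k}) \o polyC.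

(* The function field k(x)[y] / (y^2 + y + f) of the curve C^s_{abcd}, where
   v = (a, b, c), d is a representative of the fourth coordinate and
   f = (a x^2 + b x + c) / (x^3 + s) + d. *)
Definition curveC : field_over k := FieldOver AS_cst.

Definition fun_y : curveC := 'qX : {poly %/ AS_poly s (val v) d}.

Definition ratfun_x : ratfun k := 'X%:F.

(* phi is the automorphism (x, y) |-> (g(x), y + w(x)) *)
Definition aut_form (phi : curve_aut curveC) (g w : ratfun k) : Prop :=
  pull phi (AS_ratfun ratfun_x) = AS_ratfun g /\
  pull phi fun_y = fun_y + AS_ratfun w.

End FunctionField.

Section Gamma.
Variable k : fieldType.

(* Gamma is the group of fractional linear transformations x |-> eps x with
   eps a cube root of unity. *)
Record Gamma := GammaOf { eps : k; _ : eps ^+ 3 == 1 }.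
HB.instance Definition _ := [isSub for eps].
HB.instance Definition _ := [Choice of Gamma by <:].

Definition Gamma_ratfun (g : Gamma) : ratfun k := (eps g *: 'X)%:F.

Lemma epsP (g : Gamma) : eps g ^+ 3 = 1.
Proof. exact: (eqP (valP g)). Qed.
Lemma eps_neq0 (g : Gamma) : eps g != 0.
Proof. by have := oner_neq0 k; rewrite -(epsP g) expf_eq0. Qed.

Fact Gamma_one_subproof : (1 : k) ^+ 3 == 1. Proof. by rewrite expr1n. Qed.
Fact Gamma_inv_subproof (g : Gamma) : (eps g)^-1 ^+ 3 == 1.
Proof. by rewrite exprVn epsP invr1. Qed.
Fact Gamma_mul_subproof (g h : Gamma) : (eps g * eps h) ^+ 3 == 1.
Proof. by rewrite exprMn !epsP mulr1. Qed.

Let one := GammaOf Gamma_one_subproof.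
Let inv g := GammaOf (Gamma_inv_subproof g).
Let mul g h := GammaOf (Gamma_mul_subproof g h).

Lemma Gamma_mulA : associative mul.
Proof. by move=> x y z; apply: val_inj; rewrite /= mulrA. Qed.
Lemma Gamma_mul1g : left_id one mul.
Proof. by move=> x; apply: val_inj; rewrite /= mul1r. Qed.
Lemma Gamma_mulg1 : right_id one mul.
Proof. by move=> x; apply: val_inj; rewrite /= mulr1. Qed.
Lemma Gamma_mulVg : left_inverse one inv mul.
Proof. by move=> x; apply: val_inj; rewrite /= mulVf ?eps_neq0. Qed.
Lemma Gamma_mulgV : right_inverse one inv mul.
Proof. by move=> x; apply: val_inj; rewrite /= mulfV ?eps_neq0. Qed.

HB.instance Definition _ := isGroup.Build Gamma
  Gamma_mulA Gamma_mul1g Gamma_mulg1 Gamma_mulVg Gamma_mulgV.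

End Gamma.

Section ParameterSpace.
Variable k : fieldType.
Hypothesis char2 : 2%N \in [pchar k].

(* Characteristic two is what makes AS k an additive subgroup. *)
Definition AS of 2%N \in [pchar k] : {pred k} :=
  fun z => `[< exists x : k, z = x + x ^+ 2 >].

Fact AS_zmod_closed : zmod_closed (AS char2).
Proof.
split; first by apply/asboolP; exists 0; rewrite expr0n addr0.
move=> _ _ /asboolP[x ->] /asboolP[y ->]; apply/asboolP; exists (x - y).
have two0 : 2%:R = 0 :> k by exact: pcharf0.
have opp z : - z = z :> k.
  by apply/eqP; rewrite eq_sym -addr_eq0 -mulr2n -mulr_natr two0 mulr0.
by rewrite sqrrB -[x * y *+ 2]mulr_natr two0 mulr0 subr0 !opp addrACA.
Qed.
HB.instance Definition _ := GRing.isZmodClosed.Build k (AS char2) AS_zmod_closed.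

Definition Npar : Type := (coefs k * Quotient.quot (AS char2))%type.

Fact act_subproof (v : coefs k) (g : Gamma k) :
  (eps g ^+ 2 * (val v).1.1, eps g * (val v).1.2, (val v).2) != (0, 0, 0).
Proof.
case: v => [[[a b] c] /= v0]; apply: contra v0 => /eqP E; move: E => [].
move=> /eqP; rewrite mulf_eq0 expf_eq0 (negPf (eps_neq0 g)) => /eqP-> /eqP.
by rewrite mulf_eq0 (negPf (eps_neq0 g)) => /eqP-> ->.
Qed.

Definition act (n : Npar) (g : Gamma k) : Npar :=
  (exist (fun v => is_true (v != (0, 0, 0))) _ (act_subproof n.1 g), n.2).

Definition in_isotropy (n : Npar) : {pred Gamma k} := fun g => act n g == n.

Record isotropy (n : Npar) := Isotropy { iso_val : Gamma k; _ : in_isotropy n iso_val }.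
HB.instance Definition _ n := [isSub for @iso_val n].
HB.instance Definition _ n := [Choice of isotropy n by <:].

Lemma act1 n : act n 1%g = n.
Proof.
case: n => [[[[a b] c] v0] q]; congr pair; apply: val_inj => /=.
by rewrite expr1n !mul1r.
Qed.
Lemma actM n g h : act n (g * h)%g = act (act n g) h.
Proof.
congr pair; apply: val_inj => /=.
by congr (_, _, _); ring.
Qed.

Fact isotropy_closed n : group_closed (in_isotropy n).
Proof.
split=> [|g h /eqP gn /eqP hn]; apply/eqP; first exact: act1.
by rewrite actM gn -{1}hn -actM mulgV act1.
Qed.
HB.instance Definition _ n := SubChoice_isSubGroup.Build
  (Gamma k) (in_isotropy n) (isotropy n) (isotropy_closed n).

End ParameterSpace.

Definition cyclic_subgroup (G : groupType) (x : G) (y : G) : Prop :=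
  exists m : nat, y = (x ^+ m)%g \/ y = (x ^- m)%g.

(* 1 -> S -> G -> H -> 1 is exact with right-hand map f, and f has a section *)
Definition split_exact (G H : groupType) (S : G -> Prop)
    (f : {multiplicative G -> H}) : Prop :=
  [/\ forall x, S x <-> f x = 1%g, forall y, exists x, f x = y &
      exists r : {multiplicative H -> G}, cancel r f].

(* Main.v *)
(** An isomorphism of curves is a [k]-isomorphism of function fields
    [sigma : k(x, y) -> k(x', y')]. The element [X = sigma x] satisfies a
    polynomial relation of degree at most 2 in [x'], because [sigma^-1 x'] is
    quadratic over [k(x)]. By Gauss' lemma the primitive minimal polynomial
    [A T^2 + B T + C] of [X] over [k(x')] then has coefficients of degree at
    most 2. If [X] were outside [k(x')], Artin-Schreier theory would give
    [f' + z^2 + z = AC/B^2] for some [z] in [k(x')], and the pole of the left-hand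
    side at the cubic place [h = x'^3 + s] would force [h] to divide [B], which is
    nonzero of degree at most 2. So [X] lies in [k(x')], and symmetrically for
    [sigma^-1]; hence [X] is a fractional linear function of [x'].
    Comparing poles once more, this transformation fixes the place [h], so it is
    [x' |-> eps x'] with [eps^3 = 1], as [s] is not a cube. Finally
    [sigma y = y' + r], where [r^2 + r] has no pole and is therefore a constant of
    the form [c^2 + c]. *)

Require Import Defs.
From HB Require Import structures.
From mathcomp Require Import all_boot all_order all_algebra all_field.
From mathcomp Require Import monoid ring_quotient qpoly qfpoly ring boolp.

Set Implicit Arguments.
Unset Strict Implicit.

Import GRing.Theory.
Local Open Scope ring_scope.
Local Open Scope quotient_scope.

Local Notation "x %:F" := (@FracField.tofrac _ x).

(** * Gauss' lemma for [k[x][T]] *)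

Section Gauss.
Variable k : fieldType.
Implicit Types (c d : {poly k}) (P Q R : {poly {poly k}}).

Lemma irreducible_factor c : (1 < size c)%N ->
  exists2 p, irreducible_poly p & p %| c.
Proof.
have [n] := ubnP (size c); elim: n c => // n IH c le_c c1.
have [irr|red] := pselect (irreducible_poly c); first by exists c.
have [q [q1 qc nqc]] : exists q : {poly k}, [/\ size q != 1%N, q %| c & ~~ (q %= c)].
  apply: contrapT => H; apply: red; split=> // q q1 qc.
  by apply: contrapT => nqc; apply: H; exists q; split=> //; apply/negP.
have c0 : c != 0 by rewrite -size_poly_eq0; case: (size c) c1.
have q0 : q != 0 by apply: contraNneq c0 => q0; rewrite -dvd0p -q0.
have lt_q : (size q < size c)%N.
  rewrite ltn_neqAle dvdp_leq // andbT; apply: contra nqc => /eqP sqc.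
  by rewrite -dvdp_size_eqp // sqc.
have [||p irr pq] := IH q.
- by rewrite (leq_trans lt_q).
- by rewrite ltn_neqAle eq_sym q1 lt0n size_poly_eq0.
by exists p => //; apply: dvdp_trans pq qc.
Qed.

Lemma dvdp_coefP c P :
  (forall i, c %| P`_i) -> exists R, P = c *: R.
Proof.
move=> cP; exists (\poly_(i < size P) (P`_i %/ c)); apply/polyP=> i.
rewrite coefZ coef_poly; case: ltnP => [_|le_i]; first by rewrite mulrC divpK.
by rewrite mulr0 nth_default.
Qed.

Lemma sizeYM P Q : P != 0 -> Q != 0 ->
  sizeY (P * Q) = (sizeY P + sizeY Q).-1.
Proof.
move=> P0 Q0; rewrite !sizeYE rmorphM size_mul //; by rewrite swapXY_eq0.
Qed.

Lemma sizeYC c : sizeY c%:P = size c.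
Proof. by rewrite sizeYE swapXY_polyC size_map_polyC. Qed.

Definition primitive P := forall c, (forall i, c %| P`_i) -> size c = 1%N.

(** Induction on the degree in x: splitting off a nonconstant common factor of the coefficients
    lowers [sizeY]. *)
Lemma primitive_part P : P != 0 -> exists2 c, c != 0 &
  exists2 R, P = c *: R & primitive R.
Proof.
have [n] := ubnP (sizeY P); elim: n P => // n IH P le_P P0.
have [prim|nprim] := pselect (primitive P).
  by exists 1; [rewrite oner_eq0|exists P; rewrite ?scale1r].
have [c cP c1] : exists2 c, (forall i, c %| P`_i) & size c != 1%N.
  apply: contrapT => H; apply: nprim => c cP.
  by apply/eqP/negPn/negP => c1; apply: H; exists c.
have [R PE] := dvdp_coefP cP.
have c0 : c != 0 by apply: contraNneq P0 => c0; rewrite PE c0 scale0r.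
have R0 : R != 0 by apply: contraNneq P0 => R0; rewrite PE R0 scaler0.
have lt_RP : (sizeY R < sizeY P)%N.
  rewrite PE -mul_polyC sizeYM ?polyC_eq0 // sizeYC.
  move: c1 c0; rewrite -size_poly_eq0.
  by case: (size c) => [|[|m]] // _ _; rewrite addSn /= addSn ltnS leq_addl.
have [|e e0 [R1 RE prim]] := IH R _ R0; first by rewrite (leq_trans lt_RP).
by exists (c * e); [rewrite mulf_neq0|exists R1; rewrite // -scalerA -RE].
Qed.

(** An irreducible of k[x] stays prime in k[x][T]. If [m] is the least index at which [d] fails to
    divide a coefficient of [P], then modulo [d] the coefficient of index [i + m] of [R * P] reduces
    to the single product of [R]_i[and]P[_m], by strong induction on [i]. *)
Lemma irreducible_dvd_coefM d P R : irreducible_poly d ->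
  (forall i, d %| (R * P)`_i) -> ~ (forall i, d %| P`_i) ->
  forall i, d %| R`_i.
Proof.
move=> irr dRP dP.
have exP : exists i, ~~ (d %| P`_i).
  by apply: contrapT => H; apply: dP => i; apply: contrapT => /negP ?; apply: H; exists i.
case: (ex_minnP exP) => m dPm minm i.
have [n] := ubnP i; elim: n i => // n IH i; rewrite ltnS => le_in.
have := dRP (i + m)%N; rewrite coefM.
have lt_i : (i < (i + m).+1)%N by rewrite ltnS leq_addr.
rewrite (bigD1 (Ordinal lt_i)) //= addKn dvdp_addl => [|].
  by rewrite Gauss_dvdpl // irreducible_poly_coprime.
apply: (big_ind (fun z => d %| z)) => [||l ne_l]; [exact: dvdp0|exact: dvdp_add|].
have {ne_l} ne_l : (l : nat) != i by apply: contra ne_l => /eqP e; apply/eqP/val_inj.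
case: (ltngtP l i) ne_l => // lt_l _.
  by rewrite dvdp_mulr // IH // (leq_trans lt_l).
rewrite dvdp_mull //; apply: contraT => /minm; rewrite leqNgt => /negP[].
by rewrite ltn_subLR ?ltn_add2r // -ltnS ltn_ord.
Qed.

(** The irreducible factors of [c] are cancelled one at a time: each divides all coefficients of
    [R * P], hence those of [R], because [P] is primitive. *)
Lemma Gauss_primitive c P Q R : primitive P -> c != 0 ->
  c *: Q = R * P -> exists R', Q = R' * P.
Proof.
move=> prim; have [n] := ubnP (size c); elim: n c R => // n IH c R le_c c0 E.
have [c1|c1] := leqP (size c) 1.
  have cE : c = (c`_0)%:P by exact: size1_polyC.
  have e0 : c`_0 != 0 by apply: contraNneq c0 => e0; rewrite cE e0.
  exists ((c`_0)^-1%:P *: R); rewrite -scalerAl -E scalerA [in X in _ * X]cE -polyCM.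
  by rewrite mulVf // scale1r.
have [d irr dc] := irreducible_factor c1.
have dR i : d %| R`_i.
  apply: (irreducible_dvd_coefM (P := P)) => // [j|dP].
    by rewrite -E coefZ dvdp_mulr.
  by case: irr; rewrite (prim d dP).
have [R1 RE] := dvdp_coefP dR.
have d0 := irredp_neq0 irr.
have E1 : (c %/ d) *: Q = R1 * P.
  have dP0 : d%:P != 0 :> {poly {poly k}} by rewrite polyC_eq0.
  apply: (mulfI dP0); rewrite !mul_polyC scalerA mulrC divpK // E RE.
  by rewrite scalerAl.
apply: (IH (c %/ d) R1) => //; last by rewrite dvdp_div_eq0.
rewrite size_divp //; case: irr => d1 _.
apply: leq_trans (le_c : (size c <= n)%N).
move: d1 c1; case: (size d) => [|[|m]] //= _.
by case: (size c) => // l _; rewrite subSS ltnS leq_subr.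
Qed.

End Gauss.

(** * Minimal polynomials and their degree in x *)

Section Height.
Variables (k : fieldType) (L : fieldType) (phi : {rmorphism {poly k} -> L}).
Hypothesis phi0 : forall c, phi c = 0 -> c = 0.
Variable X : L.

Definition annihilates (P : {poly {poly k}}) := (map_poly phi P).[X] = 0.

(** By Gauss' lemma a primitive annihilator of least degree in T divides [Q] in k[x][T] itself, and
    degrees in x add up in a product. *)
Lemma minimal_annihilator_height (P0 Q : {poly {poly k}}) :
  P0 != 0 -> annihilates P0 ->
  (forall S : {poly {poly k}}, (size S < size P0)%N -> annihilates S -> S = 0) ->
  Q != 0 -> annihilates Q ->
  exists P : {poly {poly k}},
    [/\ P != 0, size P = size P0, annihilates P & (sizeY P <= sizeY Q)%N].
Proof.
move=> nz0 an0 min0 nzQ anQ.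
have [c c0 [P PE prim]] := primitive_part nz0.
have szP : size P = size P0 by rewrite PE size_scale.
have nzP : P != 0 by rewrite -size_poly_eq0 szP size_poly_eq0.
have anP : annihilates P.
  move: an0; rewrite /annihilates PE linearZ /= hornerZ => /eqP.
  by rewrite mulf_eq0 => /orP[/eqP/phi0 e|/eqP //]; rewrite e eqxx in c0.
(* Pseudo-division scales [Q] by a power of the leading coefficient of [P]. The remainder
   annihilates [X] in too small a degree, so it vanishes. *)
have E := Pdiv.Idomain.divp_eq Q P.
have S0 : Q %% P = 0.
  apply: min0; first by rewrite -szP ltn_modpN0.
  move: (congr1 (fun T => (map_poly phi T).[X]) E).
  rewrite linearZ rmorphD rmorphM /= hornerZ hornerD hornerM.
  rewrite (_ : (map_poly phi P).[X] = 0) // (_ : (map_poly phi Q).[X] = 0) //.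
  by rewrite !mulr0 add0r.
rewrite S0 addr0 in E.
have [|R QE] := Gauss_primitive prim _ E; first by rewrite expf_neq0 // lead_coef_eq0.
exists P; split=> //.
have R0 : R != 0 by apply: contraNneq nzQ => e; rewrite QE e mul0r.
rewrite QE sizeYM //; have : sizeY R != 0%N by rewrite sizeY_eq0.
by case: (sizeY R) => // m _; rewrite addSn leq_addl.
Qed.
End Height.

(** * Poles of Artin-Schreier expressions *)

Lemma AS_pole_clear (L : fieldType) (q h d p m N D : L) :
  h != 0 -> m != 0 -> D != 0 ->
  q / h + d + ((p / m) ^+ 2 + p / m) = N / D ->
  D * (q * m ^+ 2 + d * h * m ^+ 2 + h * (p ^+ 2 + p * m)) = h * m ^+ 2 * N.
Proof.
move=> h0 m0 D0 E; have NE : N = N / D * D by rewrite divfK.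
by rewrite [in RHS]NE -E; field; rewrite m0.
Qed.

Section Poles.
Variables (k : fieldType) (h : {poly k}).
Hypothesis irr_h : irreducible_poly h.
Implicit Types (p q m N D : {poly k}) (z : ratfun k) (d : k).

Let h0 : h != 0 := irredp_neq0 irr_h.

Lemma irreducible_dvdX p n : h %| p ^+ n -> h %| p.
Proof.
have [//|nhp] := boolP (h %| p).
have chp : coprimep h (p ^+ n) by rewrite coprimep_expr // irreducible_poly_coprime.
rewrite -[p ^+ n]mulr1 Gauss_dvdpr // dvdp1.
by case: irr_h => + _; case: (size h) => [|[]].
Qed.

(* At the place [h], [q/h + d] has a simple pole, while any pole of [z^2 + z] has
   even order: the two cannot cancel. *)
Lemma AS_pole q d z N D : q != 0 -> (size q < size h)%N -> D != 0 ->
  q%:F / h%:F + d%:P%:F + (z ^+ 2 + z) = N%:F / D%:F -> h %| D.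
Proof.
move=> q0 szq D0; have [p [m [m0 cpm ->]]] := ratfun_coprime z.
move=> /AS_pole_clear; rewrite !tofrac_eq0 => /(_ h0 m0 D0).
rewrite -!(tofracXn, tofracM, tofracD) => /eqP; rewrite tofrac_eq => /eqP E.
apply: contraT => nhD.
have chD : coprimep h D by rewrite irreducible_poly_coprime.
have hm : h %| m.
  have : h %| q * m ^+ 2.
    have : h %| D * (q * m ^+ 2 + d%:P * h * m ^+ 2 + h * (p ^+ 2 + p * m)).
      by rewrite E -mulrA dvdp_mulr.
    rewrite Gauss_dvdpr // dvdp_addl; last by rewrite dvdp_mulr.
    by rewrite dvdp_addl // mulrAC dvdp_mull.
  rewrite Gauss_dvdpr; first exact: irreducible_dvdX.
  rewrite irreducible_poly_coprime //; apply/negP => /(dvdp_leq q0).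
  by rewrite leqNgt szq.
have hp : h %| p.
  apply: (@irreducible_dvdX _ 2).
  move: hm => /dvdpP[n mE]; move: E; rewrite mE => E.
  have : h %| D * (q * n ^+ 2 * h + d%:P * n ^+ 2 * h * h + (p ^+ 2 + p * n * h)).
    apply/dvdpP; exists (h * n ^+ 2 * N); apply: (mulfI h0).
    transitivity (h * (n * h) ^+ 2 * N); last by ring.
    by rewrite -E; ring.
  rewrite Gauss_dvdpr // dvdp_addr; last by rewrite dvdp_add // dvdp_mull.
  by rewrite dvdp_addl // dvdp_mull.
case: irr_h => + _; move/coprimepP: cpm => /(_ h hp hm).
by rewrite -size_poly_eq1 => /eqP->.
Qed.

(** In characteristic two, adding [z ^+ 2 + z] to both sides gives 0 = 0 / 1 on the right, so a
    nonzero [q] would contradict [AS_pole]. Once [z ^+ 2 + z] is the constant [d], the denominator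
    of [z] divides its numerator and is a unit. *)
Lemma AS_regular (two : 2%:R = 0 :> k) q d z : (size q < size h)%N ->
  z ^+ 2 + z = q%:F / h%:F + d%:P%:F -> q = 0 /\ exists c, d = c + c ^+ 2.
Proof.
move=> szq E.
have q0 : q = 0.
  apply: contrapT => /eqP q0.
  suff : h %| 1 by rewrite dvdp1; case: irr_h => + _; case: (size h) => [|[]].
  apply: (@AS_pole q d z 0 1) => //; first exact: oner_neq0.
  rewrite -E -mulr2n -mulr_natl (_ : 2%:R = 2%:R%:P%:F :> ratfun k).
    by rewrite two !tofrac0 !mul0r.
  by rewrite !rmorph_nat.
have clear (L : fieldType) (p m : L) : m != 0 ->
    ((p / m) ^+ 2 + p / m) * m ^+ 2 = p ^+ 2 + p * m by move=> m0; field.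
split=> //; move: E; rewrite q0 tofrac0 mul0r add0r.
have [p [m [m0 cpm ->]]] := ratfun_coprime z => /(congr1 (fun t => t * m%:F ^+ 2)).
rewrite clear ?tofrac_eq0 //.
rewrite -!(tofracXn, tofracM, tofracD) => /eqP; rewrite tofrac_eq => /eqP E.
have mp : m %| p.
  have : m %| p * p.
    have : m %| p ^+ 2 + p * m by rewrite E dvdp_mull // dvdp_mulr.
    by rewrite dvdp_addl // dvdp_mull.
  by rewrite Gauss_dvdpr // coprimep_sym.
have m1 : size m == 1%N.
  by rewrite size_poly_eq1; move/coprimepP: cpm; apply.
have [c c0 mE] : exists2 c, c != 0 & m = c%:P by apply/size_poly1P.
(* The witness is the value of the polynomial [z] at 0. *)
exists (p.[0] / c).
have {}E : p.[0] ^+ 2 + p.[0] * c = d * c ^+ 2.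
  have := congr1 (fun t => t.[0]) E.
  by rewrite mE /= !(hornerD, hornerM, horner_exp, hornerC).
apply: (mulIf (expf_neq0 2 c0)); rewrite -E.
by field.
Qed.
End Poles.

Lemma ratfun_common_denominator (k : fieldType) (u v : ratfun k) :
  exists D N M : {poly k}, [/\ D != 0, u = N%:F / D%:F & v = M%:F / D%:F].
Proof.
have [p [m [m0 _ ->]]] := ratfun_coprime u.
have [q [n [n0 _ ->]]] := ratfun_coprime v.
exists (m * n), (p * n), (q * m).
have cancel (L : fieldType) (a b c : L) : c != 0 -> a / b = a * c / (b * c).
  by move=> c0; rewrite -mulf_div divff // mulr1.
split; first exact: mulf_neq0.
  by rewrite !tofracM; apply: cancel; rewrite tofrac_eq0.
by rewrite !tofracM [m%:F * _]mulrC; apply: cancel; rewrite tofrac_eq0.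
Qed.

(** * Fractional linear maps fixing the cubic place *)

Section Mobius.
Variables (k : fieldType) (s : k).
Hypothesis two : 2%:R = 0 :> k.
Hypothesis s_irr : irreducible_poly ('X^3 + s%:P).

Lemma size_h : size ('X^3 + s%:P) = 4%N.
Proof. by rewrite size_polyDl size_polyXn // size_polyC; case: eqP. Qed.

Lemma irreducible_not_cube c : s <> c ^+ 3.
Proof.
move=> sE; have [_ /(_ ('X - (- c)%:P))] := s_irr.
rewrite size_XsubC => /(_ isT); rewrite dvdp_XsubCl rootE !hornerE.
rewrite [X in X == 0](_ : _ = 0) => [/(_ (eqxx _))/eqp_size|].
  by rewrite size_XsubC size_h.
by rewrite sE; ring.
Qed.

(** The divisibility says that the map x -> (a x + b) / (c x + e) fixes the place of the cubic. Both
    polynomials have degree at most 3, so the quotient is a constant, and the coefficients of degree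
    1 and 2 must vanish. *)
Lemma mobius_stabilizer (a b c e : k) : a * e != b * c ->
  'X^3 + s%:P %| (a *: 'X + b%:P) ^+ 3 + s%:P * (c *: 'X + e%:P) ^+ 3 ->
  [/\ b = 0, c = 0 & a ^+ 3 = e ^+ 3].
Proof.
move=> det /dvdpP[q].
have s0 : s != 0.
  by apply/eqP => s0; apply: (@irreducible_not_cube 0); rewrite s0 expr0n.
pose c3 := a ^+ 3 + s * c ^+ 3; pose c2 := a ^+ 2 * b + s * (c ^+ 2 * e).
pose c1 := a * b ^+ 2 + s * (c * e ^+ 2); pose c0 := b ^+ 3 + s * e ^+ 3.
rewrite (_ : _ + _ = Poly [:: c0; c1; c2; c3]); last first.
  have three : 3%:R = 1 :> {poly k} by rewrite -polyC_natr -natr1 two add0r.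
  rewrite /= !cons_poly_def mul0r add0r -!mul_polyC.
  rewrite /c3 /c2 /c1 /c0 !(polyCD, polyCM, rmorphXn) /=.
  by ring: three.
move=> E.
have szq : (size q <= 1)%N.
  have [->|q0] := eqVneq q 0; first by rewrite size_poly0.
  have := size_Poly [:: c0; c1; c2; c3].
  rewrite E size_mul //; last by rewrite -size_poly_eq0 size_h.
  by rewrite size_h addn4 /= -[4%N]/(3 + 1)%N -addn3 addnC leq_add2l.
move: E; rewrite [q]size1_polyC //; set l := q`_0 => E.
have := congr1 (fun p : {poly k} => (p`_0, p`_1, p`_2, p`_3)) E.
rewrite !coefCM !coefD !coefXn !coefC !coef_Poly /= !addr0 !add0r !mulr0 mulr1.
move=> [E0 E1 E2 E3].
(* Two combinations of the vanishing coefficients [c1] and [c2] factor through the determinant: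
   [c2 * e - c1 * c] cancels the terms in [s], and [c1 * a - c2 * b] keeps only those. *)
have ab : a * b = 0.
  apply/eqP; have : a * b * (a * e - b * c) == 0.
    have -> : a * b * (a * e - b * c) = c2 * e - c1 * c by rewrite /c1 /c2; ring.
    by rewrite E1 E2 !mul0r subr0.
  by rewrite mulf_eq0 [_ - _ == 0]subr_eq0 (negPf det) orbF.
have ce : c * e = 0.
  apply/eqP; have : s * (c * e) * (a * e - b * c) == 0.
    have -> : s * (c * e) * (a * e - b * c) = c1 * a - c2 * b.
      by rewrite /c1 /c2; ring.
    by rewrite E1 E2 !mul0r subr0.
  by rewrite !mulf_eq0 [_ - _ == 0]subr_eq0 (negPf det) (negPf s0) orbF.
move/eqP: ab; rewrite mulf_eq0 => /orP[]/eqP z.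
  move: det; rewrite z mul0r eq_sym mulf_eq0 negb_or => /andP[b0 cn0].
  move/eqP: ce; rewrite mulf_eq0 (negPf cn0) /= => /eqP e0.
  (* If [a = 0], then also [e = 0], and the outer coefficients give b^3 = s^2 c^3, which makes [s]
     the cube of [s * c / b]. *)
  case: (@irreducible_not_cube (s * c / b)).
  rewrite expr_div_n; apply: (canRL (mulfK _)); first by rewrite expf_neq0.
  move: E0 E3; rewrite /c0 /c3 z e0 expr0n /= mulr0 add0r addr0 => -> <-; ring.
have c00 : c = 0.
  by move: det; rewrite z mul0r mulf_eq0 negb_or => /andP[_ e0]; move/eqP: ce;
    rewrite mulf_eq0 (negPf e0) orbF => /eqP.
split=> //; apply: (mulfI s0); move: E0 E3.
by rewrite /c0 /c3 z c00 expr0n /= mulr0 add0r addr0 => -> ->; rewrite mulrC.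
Qed.

End Mobius.

(** * Artin-Schreier extensions of [k(x)] *)

Definition numer (k : fieldType) (v : k * k * k) : {poly k} :=
  v.1.1 *: 'X^2 + v.1.2 *: 'X + v.2%:P.

Lemma size_numer (k : fieldType) (v : k * k * k) : (size (numer v) <= 3)%N.
Proof.
by apply/leq_sizeP => -[|[|[|i]]] // _; rewrite /numer !coefE /= !mulr0 !addr0.
Qed.

Lemma numer_inj (k : fieldType) : injective (@numer k).
Proof.
move=> [[a b] c] [[a' b'] c'] /(congr1 (fun p : {poly k} => (p`_2, p`_1, p`_0))).
by rewrite /numer !coefE /= !(mulr0, mulr1, addr0, add0r).
Qed.

Lemma AS_rhsE (k : fieldType) (s : k) v d :
  AS_rhs s v d = (numer v)%:F / ('X^3 + s%:P)%:F + d%:P%:F.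
Proof. by case: v => [[a b] c]. Qed.

(** [L] has basis 1, [y] over k(x). Freeness is stated as [w = 0] alone, since [u = 0] then follows
    from the injectivity of [j]. *)
Definition AS_extension (k : fieldType) (f : ratfun k) (L : fieldType)
    (j : {rmorphism ratfun k -> L}) (y : L) : Prop :=
  [/\ y ^+ 2 + y = j f, forall z, exists u w, z = j u + j w * y
    & forall u w, j u + j w * y = 0 -> w = 0].

Section Extension.
Variables (k : fieldType) (f : ratfun k) (L : fieldType).
Variables (j : {rmorphism ratfun k -> L}) (y : L).
Hypothesis ext : AS_extension f j y.
Hypothesis two : 2%:R = 0 :> k.

Definition poly_emb : {rmorphism {poly k} -> L} := j \o @FracField.tofrac {poly k}.

Lemma poly_emb_eq0 p : poly_emb p = 0 -> p = 0.
Proof.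
move=> /eqP; rewrite /= fmorph_eq0 => /eqP e.
by apply/eqP; rewrite -tofrac_eq0 e eqxx.
Qed.

Lemma two_ext : 2%:R = 0 :> L.
Proof. by rewrite -(rmorph_nat poly_emb) -polyC_natr two rmorph0. Qed.

Lemma two_ratfun : 2%:R = 0 :> ratfun k.
Proof. by rewrite -(rmorph_nat (@FracField.tofrac {poly k})) -polyC_natr two rmorph0. Qed.

Lemma ext_eq u w u' w' : j u + j w * y = j u' + j w' * y -> u = u' /\ w = w'.
Proof.
move=> E; have [_ _ free] := ext.
have ww : w = w'.
  apply/eqP; rewrite -subr_eq0; apply/eqP/(free (u - u')).
  apply/eqP; rewrite !rmorphB mulrBl addrACA -opprD E subrr //.
split=> //; move: E; rewrite ww => /addIr; exact: fmorph_inj.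
Qed.

(** Coordinates in the basis 1, [y]: in characteristic two y^2 = f + y, and the cross term of the
    square vanishes. *)
Lemma ext_quadratic (a b c u w : ratfun k) :
  j a * (j u + j w * y) ^+ 2 + j b * (j u + j w * y) + j c =
  j (a * (u ^+ 2 + w ^+ 2 * f) + b * u + c) + j (a * w ^+ 2 + b * w) * y.
Proof.
have [y2 _ _] := ext; have {}y2 : y ^+ 2 = j f - y by rewrite -y2 addrK.
have t := two_ext.
rewrite !(rmorphD, rmorphM, rmorphXn) /=.
move: (j a) (j b) (j c) (j u) (j w) (j f) y y2 => a' b' c' u' w' f' z z2.
rewrite !sqrrD !exprMn z2 -mulr_natr t.
apply/eqP; rewrite -subr_eq0; apply/eqP.
transitivity (2%:R * (- a' * w' ^+ 2 * z)); last by rewrite t mul0r.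
by rewrite mulr0; ring.
Qed.

(** For z = u + w y the trace is w and the norm is u^2 + w u + w^2 f; a common denominator is then
    cleared. *)
Lemma quadratic_annihilator z : exists A B C : {poly k}, A != 0 /\
  poly_emb A * z ^+ 2 + poly_emb B * z + poly_emb C = 0.
Proof.
have [_ span _] := ext; have [u [w ->]] := span z.
have [D [N [M [D0 wE cE]]]] :=
  ratfun_common_denominator w (u ^+ 2 + w ^+ 2 * f + w * u).
have D0' : D%:F != 0 by rewrite tofrac_eq0.
exists D, N, M; split=> //=.
have -> : N%:F = w * D%:F by rewrite wE divfK.
have -> : M%:F = (u ^+ 2 + w ^+ 2 * f + w * u) * D%:F by rewrite cE divfK.
rewrite ext_quadratic.
have -> : D%:F * (u ^+ 2 + w ^+ 2 * f) + w * D%:F * u +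
    (u ^+ 2 + w ^+ 2 * f + w * u) * D%:F =
    2%:R * (D%:F * (u ^+ 2 + w ^+ 2 * f) + w * D%:F * u).
  by move: D%:F f => D' f'; ring.
have -> : D%:F * w ^+ 2 + w * D%:F * w = 2%:R * (D%:F * w ^+ 2).
  by move: D%:F => D'; ring.
by rewrite two_ratfun !mul0r !rmorph0 mul0r addr0.
Qed.

End Extension.

Lemma horner_size3 (R S : nzRingType) (phi : {rmorphism R -> S}) (P : {poly R}) x :
  (size P <= 3)%N ->
  (map_poly phi P).[x] = phi P`_2 * x ^+ 2 + phi P`_1 * x + phi P`_0.
Proof.
move=> szP; rewrite (@horner_coef_wide _ 3).
  by rewrite !big_ord_recr big_ord0 /= !coef_map add0r expr0 mulr1 addrC
    [_ + phi P`_1 * _]addrC addrA.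
by apply: leq_trans szP; rewrite size_poly.
Qed.

(** Division by [a * w ^+ 2]. The denominator is written as [(a * w) ^+ 2] because [a * w] will be
    the middle coefficient of the minimal polynomial, a polynomial in x. *)
Lemma quadratic_AS_form (K : fieldType) (f a c u w : K) : a != 0 -> w != 0 ->
  f * a * w ^+ 2 + a * u ^+ 2 + a * w * u + c = 0 ->
  f + ((u / w) ^+ 2 + u / w) = - (a * c) / (a * w) ^+ 2.
Proof.
move=> a0 w0 E; have -> : c = - (f * a * w ^+ 2 + a * u ^+ 2 + a * w * u).
  by apply/eqP; rewrite -addr_eq0 addrC E.
by field; rewrite a0 w0.
Qed.

Section HyperellipticFunction.
Variables (k : fieldType) (s : k) (v : k * k * k) (d : k).
Hypothesis two : 2%:R = 0 :> k.
Hypothesis s_irr : irreducible_poly ('X^3 + s%:P).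
Hypothesis v0 : v != (0, 0, 0).
Variables (L : fieldType) (j : {rmorphism ratfun k -> L}) (y : L).
Hypothesis ext : AS_extension (AS_rhs s v d) j y.

Let phi := poly_emb j.

Lemma numer_neq0 : numer v != 0.
Proof.
apply: contra v0 => /eqP e; apply/eqP/numer_inj.
by rewrite e /numer /= !scale0r !addr0.
Qed.

Lemma size_numer_lt : (size (numer v) < size ('X^3 + s%:P)%R)%N.
Proof. by rewrite size_h ltnS size_numer. Qed.

Lemma AS_rhs_pole z N D : D != 0 ->
  AS_rhs s v d + (z ^+ 2 + z) = N%:F / D%:F -> 'X^3 + s%:P %| D.
Proof.
by rewrite AS_rhsE; apply: AS_pole; rewrite ?numer_neq0 ?size_numer_lt.
Qed.

(* If [X] were outside [k(x)], its minimal polynomial [A T^2 + B T + C] over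
   [k(x)] would have coefficients of degree at most 2, while completing it to
   Artin-Schreier form gives [f + z^2 + z = AC/B^2]; the pole of [f] then
   forces the cubic to divide [B]. *)
Lemma degree2_in_ratfun (X : L) (Q : {poly {poly k}}) :
  Q != 0 -> annihilates phi X Q -> (sizeY Q <= 3)%N ->
  exists u, X = j u.
Proof.
move=> Q0 anQ szQ; have [_ span free] := ext.
have [u [w XE]] := span X; have [w0|w0] := eqVneq w 0.
  by exists u; rewrite XE w0 rmorph0 mul0r addr0.
have [A [B [C [A0 E]]]] := quadratic_annihilator ext two X.
pose P0 : {poly {poly k}} := Poly [:: C; B; A].
have P0s : size P0 = 3%N by rewrite (@PolyK _ 0) //=.
have P0n : P0 != 0 by rewrite -size_poly_eq0 P0s.
have zeroE : 0 = j 0 + j 0 * y by rewrite rmorph0 mul0r addr0.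
have an (P : {poly {poly k}}) : (size P <= 3)%N -> annihilates phi X P ->
    AS_rhs s v d * (P`_2)%:F * w ^+ 2 + (P`_2)%:F * u ^+ 2 + (P`_1)%:F * u + (P`_0)%:F = 0
    /\ (P`_2)%:F * w ^+ 2 + (P`_1)%:F * w = 0.
  move=> szP; rewrite /annihilates horner_size3 // XE.
  rewrite (ext_quadratic ext two) => E1.
  have /(ext_eq ext)[/= e1 e2] := etrans E1 zeroE.
  split; last exact: e2.
  rewrite -[RHS]e1.
  by move: (AS_rhs s v d) (P`_2)%:F (P`_1)%:F (P`_0)%:F => f a b c; ring.
have [|S|P [Pn szP anP szYP]] :=
    minimal_annihilator_height (poly_emb_eq0 (j := j)) P0n _ _ Q0 anQ.
- rewrite /annihilates horner_size3 ?P0s // !coef_Poly /=; exact: E.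
(* As [w] is nonzero, no nonzero polynomial of degree at most one annihilates [X]: the coordinate
   along [y] kills the leading coefficient, and the other coordinate kills the constant term. *)
- rewrite P0s ltnS => szS /an[]; first exact: leqW.
  have -> : S`_2 = 0 by rewrite nth_default.
  rewrite !(tofrac0, mulr0, mul0r, add0r) => e0 /eqP.
  rewrite mulf_eq0 tofrac_eq0 (negPf w0) orbF => /eqP e1.
  move: e0; rewrite e1 tofrac0 mul0r add0r => /eqP; rewrite tofrac_eq0 => /eqP e0.
  rewrite (size1_polyC (_ : size S <= 1)%N) ?e0 //.
  by apply/leq_sizeP => -[|[|i]] // _; rewrite nth_default // (leq_trans szS).
rewrite P0s in szP.
have [|e0 e1] := an P _ anP; first by rewrite szP.
set a := P`_2 in e0 e1; set b := P`_1 in e0 e1; set c := P`_0 in e0.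
have a0 : a != 0 by rewrite /a -[2%N]/(3.-1)%N -szP -lead_coefE lead_coef_eq0.
have twoK := two_ratfun two.
(* The coordinate along [y] is [a * w ^+ 2 + b * w = 0], and signs disappear in characteristic
   two. *)
have bE : b%:F = a%:F * w.
  apply: (mulIf w0); apply/eqP; rewrite -subr_eq0; apply/eqP.
  transitivity (a%:F * w ^+ 2 + b%:F * w - 2%:R * (a%:F * w ^+ 2)).
    by move: a%:F b%:F => a' b'; ring.
  by rewrite twoK mul0r subr0.
have b0 : b != 0.
  by rewrite -tofrac_eq0 bE mulf_neq0 ?tofrac_eq0.
have hb : 'X^3 + s%:P %| b ^+ 2.
  apply: (@AS_rhs_pole (u / w) (- (a * c)) (b ^+ 2)); first by rewrite expf_neq0.
  rewrite tofracN tofracM tofracXn bE.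
  have aF0 : a%:F != 0 by rewrite tofrac_eq0.
  rewrite bE in e0.
  exact: (quadratic_AS_form aF0 w0 e0).
have := dvdp_leq b0 (irreducible_dvdX s_irr hb).
rewrite size_h leqNgt ltnS => /negP[].
by apply: leq_trans szQ; apply: leq_trans szYP; apply: max_size_coefXY.
Qed.
End HyperellipticFunction.

(** * Isomorphisms of function fields *)

(** This exhibits [p ^+ 3 + s * m ^+ 3] as a denominator of f(p/m), the form to which the pole lemma
    applies. *)
Lemma mobius_substitution (K : fieldType) (a b c d s p m : K) :
  m != 0 -> p ^+ 3 + s * m ^+ 3 != 0 ->
  (a * (p / m) ^+ 2 + b * (p / m) + c) / ((p / m) ^+ 3 + s) + d =
  (m * (a * p ^+ 2 + b * p * m + c * m ^+ 2) + d * (p ^+ 3 + s * m ^+ 3)) /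
  (p ^+ 3 + s * m ^+ 3).
Proof. by move=> m0 H0; field; rewrite m0 H0. Qed.

Section Isomorphism.
Variables (k : fieldType) (f f' : ratfun k) (L M : fieldType).
Variables (j : {rmorphism ratfun k -> L}) (y : L).
Variables (i : {rmorphism ratfun k -> M}) (t : M).
Hypothesis two : 2%:R = 0 :> k.
Hypothesis extL : AS_extension f j y.
Variables (sigma : {rmorphism L -> M}) (tau : M -> L).
Hypothesis tauK : cancel tau sigma.
Hypothesis sigma_cst : forall c, sigma (poly_emb j c%:P) = poly_emb i c%:P.

Let X := sigma (poly_emb j 'X).

(** [sigma] sends the value of [Q] at (x, z) to its value at (X, x'). Swapping the variables reads
    the latter as a polynomial in [X] with coefficients in k[x']. *)
Lemma horner_swap (Q : {poly {poly k}}) z : sigma z = poly_emb i 'X ->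
  (map_poly (poly_emb i) (swapXY Q)).[X] = sigma (map_poly (poly_emb j) Q).[z].
Proof.
move=> zE; elim/poly_ind: Q => [|Q c IH].
  by rewrite !(rmorph0, horner0).
rewrite !(rmorphD, rmorphM) /= swapXY_X swapXY_polyC map_polyX !map_polyC /=.
rewrite !(hornerD, hornerM, hornerC, hornerX) !(rmorphD, rmorphM) /= zE IH.
congr (_ + _); elim/poly_ind: c => [|c a IHc]; first by rewrite !(rmorph0, horner0).
rewrite !(rmorphD, rmorphM) /= !map_polyC /= !map_polyX.
rewrite !(hornerD, hornerM, hornerC, hornerX) IHc; congr (_ + _).
exact/esym/sigma_cst.
Qed.

(** The element [tau] x' is quadratic over k(x); the swap turns this degree 2 in T into a bound on
    the degree of the coefficients. *)
Lemma transported_annihilator : exists Q : {poly {poly k}},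
  [/\ Q != 0, annihilates (poly_emb i) X Q & (sizeY Q <= 3)%N].
Proof.
have [A [B [C [A0 E]]]] := quadratic_annihilator extL two (tau (poly_emb i 'X)).
pose Q : {poly {poly k}} := Poly [:: C; B; A].
have szQ : size Q = 3%N by rewrite (@PolyK _ 0).
exists (swapXY Q); split.
- by rewrite swapXY_eq0 -size_poly_eq0 szQ.
- rewrite /annihilates (horner_swap _ (tauK _)) horner_size3 ?szQ //.
  by rewrite !coef_Poly [X in sigma X]E rmorph0.
- by rewrite sizeYE swapXYK szQ.
Qed.

(** [X] has a linear minimal polynomial over k(x'). The swapped linear relation for [tau] x' bounds
    the degree of its primitive coefficients by 1. *)
Lemma mobius_of_ratfun u u' : X = i u -> tau (poly_emb i 'X) = j u' ->
  exists p m : {poly k},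
    [/\ m != 0, (size p <= 2)%N, (size m <= 2)%N & X = i (p%:F / m%:F)].
Proof.
have [D [N [_ [D0 -> _]]]] := ratfun_common_denominator u' 0.
have [m [p [_ [m0 -> _]]]] := ratfun_common_denominator u 0.
move=> XE tE.
have sz2 (R : nzRingType) (a b : R) : a != 0 -> size (a%:P * 'X - b%:P) = 2%N.
  by move=> a0; rewrite -polyCN size_MXaddC polyC_eq0 (negPf a0) size_polyC a0.
have nz (R : nzRingType) (a b : R) : a != 0 -> a%:P * 'X - b%:P != 0.
  by move=> a0; rewrite -size_poly_eq0 sz2.
have phi_eq0 := poly_emb_eq0 (j := i).
have ev (F : fieldType) (l : {rmorphism ratfun k -> F}) (a b : {poly k}) :
    a != 0 -> (map_poly (poly_emb l) (a%:P * 'X - b%:P)).[l (b%:F / a%:F)] = 0.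
  move=> a0; rewrite rmorphB rmorphM /= map_polyX !map_polyC /=.
  rewrite !(hornerD, hornerN, hornerM, hornerC, hornerX) -rmorphM.
  by rewrite mulrC divfK ?tofrac_eq0 // subrr.
have [|S|||P [P0 szP anP szYP]] := minimal_annihilator_height (X := X)
  (Q := swapXY (D%:P * 'X - N%:P)) phi_eq0 (nz _ m p m0).
- by rewrite /annihilates XE ev.
- rewrite sz2 // ltnS => /size1_polyC ->; rewrite /annihilates map_polyC hornerC.
  by move=> /phi_eq0 ->; rewrite polyC0.
- by rewrite swapXY_eq0 nz.
- by rewrite /annihilates (horner_swap _ (tauK _)) tE ev // rmorph0.
rewrite sz2 // in szP; rewrite [leqRHS]sizeYE swapXYK sz2 // in szYP.
have P1 : P`_1 != 0 by rewrite -[1%N]/(2.-1)%N -szP -lead_coefE lead_coef_eq0.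
exists (- P`_0), P`_1; split=> //.
- by rewrite size_polyN (leq_trans (max_size_coefXY _ _)).
- by rewrite (leq_trans (max_size_coefXY _ _)).
move: anP; rewrite /annihilates horner_size3 ?szP // [P`_2]nth_default ?szP //.
rewrite rmorph0 mul0r add0r => /eqP; rewrite addr_eq0 => /eqP E.
have i0 : i (P`_1)%:F != 0 by rewrite fmorph_eq0 tofrac_eq0.
rewrite fmorph_div tofracN rmorphN /=; apply: (canRL (mulfK i0)).
by rewrite mulrC; exact: E.
Qed.

Definition subst_ratfun (g : ratfun k) (p : {poly k}) : ratfun k :=
  (map_poly (@FracField.tofrac {poly k} \o polyC) p).[g].

Lemma sigma_poly g p : X = i g -> sigma (poly_emb j p) = i (subst_ratfun g p).
Proof.
rewrite /subst_ratfun => XE; elim/poly_ind: p => [|p c IH].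
  by rewrite !(rmorph0, horner0).
rewrite !(rmorphD, rmorphM) /= map_polyX map_polyC /=.
rewrite !(hornerD, hornerM, hornerC, hornerX) !(rmorphD, rmorphM) /= -IH -XE.
by congr (_ + _); exact: sigma_cst.
Qed.

Lemma sigma_ratfun g u : X = i g -> exists u', sigma (j u) = i u'.
Proof.
move=> XE; have [m [p [_ [m0 -> _]]]] := ratfun_common_denominator u 0.
exists (subst_ratfun g p / subst_ratfun g m).
rewrite !fmorph_div; congr (_ / _); exact: sigma_poly.
Qed.

Hypothesis extM : AS_extension f' i t.

(** Write [sigma y] as r + w t. The coordinate along [t] of the equation of [y] reads w^2 + w = 0,
    so [w] is 0 or 1. *)
Lemma sigma_y g F : X = i g -> sigma (j f) = i F ->
  exists2 r, sigma y = t + i r & f' + (r ^+ 2 + r) = F.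
Proof.
move=> XE FE; have [yE spanL _] := extL; have [_ spanM freeM] := extM.
have [r [w YE]] := spanM (sigma y).
(* Otherwise [sigma] would map all of [L] into k(x'), although it reaches [t]. *)
have w0 : w != 0.
  apply/eqP => w0; rewrite w0 rmorph0 mul0r addr0 in YE.
  have [a [b tE]] := spanL (tau t).
  have := tauK t; rewrite tE rmorphD rmorphM YE.
  have [a' ->] := sigma_ratfun a XE; have [b' ->] := sigma_ratfun b XE.
  rewrite -rmorphM -rmorphD => E.
  have /freeM/eqP : i (a' + b' * r) + i (- 1) * t = 0.
    by rewrite E rmorphN rmorph1 mulN1r subrr.
  by rewrite oppr_eq0 oner_eq0.
have E : i 1 * (i r + i w * t) ^+ 2 + i 1 * (i r + i w * t) + i (- F) = 0.
  by rewrite rmorph1 !mul1r -YE -rmorphXn -rmorphD yE FE rmorphN subrr.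
rewrite (ext_quadratic extM two) !mul1r in E.
have w2 := freeM _ _ E.
rewrite w2 rmorph0 mul0r addr0 in E.
have {}E : r ^+ 2 + w ^+ 2 * f' + r = F.
  by apply/eqP; rewrite -subr_eq0 -(fmorph_eq0 i) E.
have w1 : w = 1.
  move: w2; rewrite expr2 -[X in _ + X]mulr1 -mulrDr => /eqP.
  rewrite mulf_eq0 (negPf w0) addr_eq0 => /eqP ->.
  apply/eqP; rewrite eq_sym -addr_eq0 -mulr2n -mulr_natl two_ratfun //.
  by rewrite mul0r.
exists r; first by rewrite YE w1 rmorph1 mul1r addrC.
by rewrite -E w1 expr1n mul1r addrCA addrA.
Qed.

End Isomorphism.

(** * Substitution into the defining equation *)

Section Substitution.
Variable k : fieldType.
Implicit Types (g : ratfun k) (w : k * k * k) (s e : k).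

Definition twist (e : k) (w : k * k * k) : k * k * k := (e ^+ 2 * w.1.1, e * w.1.2, w.2).

Lemma numer_twist e w : numer (twist e w) = numer w \Po (e *: 'X).
Proof.
rewrite /numer /= !(comp_polyD, comp_polyZ, comp_polyC, comp_Xn_poly, comp_polyX).
by rewrite exprZn !scalerA ![_ * e]mulrC ![_ * e ^+ 2]mulrC.
Qed.

Lemma subst_ratfun_poly (q p : {poly k}) : subst_ratfun q%:F p = (p \Po q)%:F.
Proof.
rewrite /subst_ratfun /comp_poly -horner_map -map_poly_comp /=.
by congr (_.[_]); apply: eq_map_poly.
Qed.

Lemma subst_ratfun_numer g w :
  subst_ratfun g (numer w) =
  w.1.1%:P%:F * g ^+ 2 + w.1.2%:P%:F * g + w.2%:P%:F.
Proof.
rewrite /subst_ratfun /numer -!mul_polyC.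
rewrite !(rmorphD, rmorphM, rmorphXn) /= !map_polyC /= !map_polyX.
by rewrite !(hornerD, hornerM, hornerXn, hornerC, hornerX).
Qed.

Lemma subst_ratfun_cubic s g :
  subst_ratfun g ('X^3 + s%:P) = g ^+ 3 + s%:P%:F.
Proof.
rewrite /subst_ratfun rmorphD rmorphXn /= map_polyC map_polyX /=.
by rewrite !(hornerD, hornerXn, hornerC).
Qed.

End Substitution.

(** * Rigidity of isomorphisms *)

Section Rigidity.
Variables (k : fieldType) (s : k).
Hypothesis two : 2%:R = 0 :> k.
Hypothesis s_irr : irreducible_poly ('X^3 + s%:P).
Variables (v v' : k * k * k) (d d' : k).
Hypotheses (v0 : v != (0, 0, 0)) (v'0 : v' != (0, 0, 0)).
Variables (L M : fieldType).
Variables (j : {rmorphism ratfun k -> L}) (y : L).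
Variables (i : {rmorphism ratfun k -> M}) (t : M).
Hypothesis extL : AS_extension (AS_rhs s v d) j y.
Hypothesis extM : AS_extension (AS_rhs s v' d') i t.
Variables (sigma : {rmorphism L -> M}) (tau : {rmorphism M -> L}).
Hypotheses (sigmaK : cancel sigma tau) (tauK : cancel tau sigma).
Hypothesis sigma_cst : forall c, sigma (poly_emb j c%:P) = poly_emb i c%:P.

Let tau_cst c : tau (poly_emb i c%:P) = poly_emb j c%:P.
Proof. by rewrite -sigma_cst sigmaK. Qed.

Let X := sigma (poly_emb j 'X).

Lemma X_mobius : exists p m : {poly k},
  [/\ m != 0, (size p <= 2)%N, (size m <= 2)%N & X = i (p%:F / m%:F)].
Proof.
have [Q [Q0 anQ szQ]] := transported_annihilator two extL tauK sigma_cst.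
have [u uE] := degree2_in_ratfun two s_irr v'0 extM Q0 anQ szQ.
have [Q' [Q'0 anQ' szQ']] := transported_annihilator two extM sigmaK tau_cst.
have [u' u'E] := degree2_in_ratfun two s_irr v0 extL Q'0 anQ' szQ'.
exact: mobius_of_ratfun tauK sigma_cst u u' uE u'E.
Qed.

Lemma sigma_AS_rhs g : X = i g ->
  sigma (j (AS_rhs s v d)) =
  i (subst_ratfun g (numer v) / subst_ratfun g ('X^3 + s%:P) + d%:P%:F).
Proof.
move=> XE; have P := sigma_poly sigma_cst _ XE.
transitivity (sigma (poly_emb j (numer v)) / sigma (poly_emb j ('X^3 + s%:P)) +
    sigma (poly_emb j d%:P)).
  by rewrite -fmorph_div -rmorphD /= -fmorph_div -rmorphD AS_rhsE.
by rewrite sigma_cst !P -fmorph_div /= -rmorphD.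
Qed.

Lemma X_nonconstant c : X <> i c%:P%:F.
Proof.
move=> E; have /eqP : sigma (poly_emb j ('X - c%:P)) = 0.
  by rewrite rmorphB [sigma _]rmorphB sigma_cst -/X E subrr.
by rewrite fmorph_eq0 => /eqP/poly_emb_eq0/eqP; rewrite polyXsubC_eq0.
Qed.

(** With X = p/m, [sigma_y] makes f(p/m) differ from f' by an Artin-Schreier expression. The pole of
    f' then forces the cubic to divide the denominator p^3 + s m^3, and [mobius_stabilizer]
    applies. *)
Lemma X_scaling : exists2 e, e ^+ 3 = 1 & X = i (e *: 'X)%:F.
Proof.
have [p [m [m0 szp szm XE]]] := X_mobius.
have lin (q : {poly k}) : (size q <= 2)%N -> q = q`_1 *: 'X + (q`_0)%:P.
  move=> szq; apply/polyP=> -[|[|n]]; rewrite !coefE /= ?mulr0 ?mulr1 ?add0r ?addr0 //.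
  by rewrite nth_default // (leq_trans szq).
(* Up to the factor m^3 this is the image under [sigma] of the nonzero cubic. *)
have H0 : p ^+ 3 + s%:P * m ^+ 3 != 0.
  have : sigma (poly_emb j ('X^3 + s%:P)) != 0.
    rewrite fmorph_eq0; apply/eqP => /poly_emb_eq0/eqP.
    by rewrite (negPf (irredp_neq0 s_irr)).
  rewrite (sigma_poly sigma_cst _ XE) fmorph_eq0 subst_ratfun_cubic.
  apply: contra => /eqP e; rewrite expr_div_n.
  have m3 : (m ^+ 3)%:F != 0 by rewrite tofrac_eq0 expf_neq0.
  apply/eqP/(mulIf m3); rewrite mul0r mulrDl -!tofracXn divfK //.
  by rewrite -tofracM -tofracD e tofrac0.
have FE := sigma_AS_rhs XE.
have [r _] := sigma_y two extL tauK sigma_cst extM XE FE.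
rewrite subst_ratfun_numer subst_ratfun_cubic mobius_substitution ?tofrac_eq0 //;
  last by rewrite -!(tofracXn, tofracM, tofracD) tofrac_eq0.
rewrite -!(tofracXn, tofracM, tofracD) => /(AS_rhs_pole s_irr v'0 H0).
rewrite [p]lin // [m]lin //.
move=> /(mobius_stabilizer two s_irr)[|p0 m1 pm].
  (* A vanishing determinant would make [p] and [m] proportional, hence [X] constant. *)
  apply/eqP => det.
  have [c pE] : exists c, p = c *: m.
    have m01 : (m`_1 != 0) || (m`_0 != 0).
      rewrite -negb_and; apply: contra m0 => /andP[/eqP m1 /eqP m00].
      by rewrite [m]lin // m1 m00 scale0r addr0.
    have prop c : c * m`_1 = p`_1 -> c * m`_0 = p`_0 -> p = c *: m.
      move=> e1 e0; rewrite (lin p szp) [in RHS](lin m szm) -e1 -e0.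
      by rewrite scalerDr scalerA -[_ *: (m`_0)%:P]mul_polyC polyCM.
    case/orP: m01 => n0.
      by exists (p`_1 / m`_1); apply: prop; rewrite ?divfK // mulrAC det mulfK.
    by exists (p`_0 / m`_0); apply: prop; rewrite ?divfK // mulrAC -det mulfK.
  apply: (@X_nonconstant c); rewrite XE pE -mul_polyC tofracM mulfK //.
  by rewrite tofrac_eq0.
have mE : m = (m`_0)%:P by rewrite [m in LHS]lin // m1 scale0r add0r.
have pE : p = p`_1 *: 'X by rewrite [p in LHS]lin // p0 addr0.
have mn0 : m`_0 != 0 by rewrite -polyC_eq0 -mE.
exists (p`_1 / m`_0); first by rewrite expr_div_n pm divff // expf_neq0.
rewrite XE; congr (i _).
have mF0 : m%:F != 0 by rewrite tofrac_eq0.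
apply: (canLR (mulfK mF0)); rewrite -tofracM; congr (_%:F).
by rewrite [RHS]mulrC {1}mE mul_polyC scalerA mulrC divfK // -pE.
Qed.

(** Since e^3 = 1, the substitution x -> e x preserves the cubic. So r^2 + r is a fraction over the
    same cubic plus a constant, and [AS_regular] makes its numerator vanish. *)
Lemma AS_isomorphism_rigidity : exists e r,
  [/\ e ^+ 3 = 1, X = i (e *: 'X)%:F, sigma y = t + i r,
      v' = twist e v & r ^+ 2 + r = (d - d')%:P%:F].
Proof.
have [e e3 XE] := X_scaling; have FE := sigma_AS_rhs XE.
have [r yE] := sigma_y two extL tauK sigma_cst extM XE FE.
rewrite !subst_ratfun_poly -numer_twist.
rewrite comp_polyD comp_Xn_poly comp_polyC exprZn e3 scale1r AS_rhsE => rE.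
have {}rE : r ^+ 2 + r =
    (numer (twist e v) - numer v')%:F / ('X^3 + s%:P)%:F + (d - d')%:P%:F.
  rewrite polyCB !tofracB mulrBl addrACA -opprD -rE.
  by rewrite addrC addKr.
have [|/eqP] := AS_regular s_irr two _ rE.
  rewrite size_h ltnS (leq_trans (size_polyD _ _)) // size_polyN geq_max.
  by rewrite !size_numer.
rewrite subr_eq0 => /eqP nE _; exists e, r; split=> //.
  by apply: numer_inj; rewrite nE.
by rewrite rE nE subrr tofrac0 mul0r add0r.
Qed.

End Rigidity.

(** * Curves and their isomorphisms *)

Section FractionLift.
Variables (k K : fieldType) (phi : {rmorphism {poly k} -> K}).
Hypothesis phi_inj : forall p, phi p = 0 -> p = 0.

Let numden (z : ratfun k) :
  {pq : {poly k} * {poly k} | pq.2 != 0 & z = pq.1%:F / pq.2%:F}.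
Proof.
by apply: cid2; have [p [q [q0 _ zE]]] := ratfun_coprime z; exists (p, q).
Qed.

(** The representing fraction is picked by choice; [frac_liftE] shows that the value does not depend
    on it. *)
Definition frac_lift z : K := phi (s2val (numden z)).1 / phi (s2val (numden z)).2.

Let phi_neq0 p : p != 0 -> phi p != 0.
Proof. by apply: contra => /eqP/phi_inj ->. Qed.

Lemma frac_liftE p q : q != 0 -> frac_lift (p%:F / q%:F) = phi p / phi q.
Proof.
move=> q0; rewrite /frac_lift; case: (numden _) => -[a b] /= b0 E.
have bF0 : b%:F != 0 by rewrite tofrac_eq0.
have qF0 : q%:F != 0 by rewrite tofrac_eq0.
move/eqP: E; rewrite (eqr_div _ _ qF0 bF0) -!tofracM tofrac_eq => /eqP E.
apply: (canLR (mulfK (phi_neq0 b0))); rewrite mulrAC.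
by apply: (canRL (mulfK (phi_neq0 q0))); rewrite -!rmorphM E.
Qed.

Lemma frac_lift_tofrac p : frac_lift p%:F = phi p.
Proof.
have := frac_liftE p (oner_neq0 _).
by rewrite tofrac1 divr1 rmorph1 divr1.
Qed.

Lemma frac_lift_zmod_morphism : zmod_morphism frac_lift.
Proof.
move=> u w; have [D [N [M [D0 -> ->]]]] := ratfun_common_denominator u w.
by rewrite -mulrBl -tofracB !frac_liftE // rmorphB mulrBl.
Qed.

Lemma frac_lift_monoid_morphism : monoid_morphism frac_lift.
Proof.
split=> [|u w]; first by rewrite -tofrac1 frac_lift_tofrac rmorph1.
have [D [N [M [D0 -> ->]]]] := ratfun_common_denominator u w.
by rewrite mulf_div -!tofracM !frac_liftE ?mulf_neq0 // !rmorphM mulf_div.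
Qed.

Lemma ratfun_rmorphism_of_poly :
  exists psi : {rmorphism ratfun k -> K}, forall p, psi p%:F = phi p.
Proof.
pose add := GRing.isZmodMorphism.Build _ _ frac_lift frac_lift_zmod_morphism.
pose mul := GRing.isMonoidMorphism.Build _ _ frac_lift frac_lift_monoid_morphism.
pose psi : {rmorphism ratfun k -> K} := HB.pack frac_lift add mul.
by exists psi => p; rewrite /= frac_lift_tofrac.
Qed.

End FractionLift.

Section Points.
Variable k : fieldType.
Implicit Types F : field_over k.

Lemma point_ext F (P Q : point F) :
  (forall f, local_ring P f <-> local_ring Q f) -> P = Q.
Proof.
case: P Q => [p p1 p2 p3 p4] [q q1 q2 q3 q4] /= pq.
have e : p = q by apply: funext => f; apply: propext.
by subst q; f_equal; apply: Prop_irrelevance.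
Qed.

(** The local ring at an image point is the preimage under [pull] of the local ring at the point, so
    [pull] determines [pt]. *)
Lemma curve_iso_ext F F' (u w : curve_iso F F') : pull u =1 pull w -> u = w.
Proof.
move=> uw; apply: curve_iso_eq => // P; apply: point_ext => f.
by rewrite !pull_local uw.
Qed.

Section PullMorphism.
Variables (F F' : field_over k) (u : curve_iso F F').

Lemma pull_zmod_morphism : zmod_morphism (pull u).
Proof.
move=> f g; apply/eqP; rewrite eq_sym subr_eq -pullD subrK //.
Qed.

Lemma pull_monoid_morphism : monoid_morphism (pull u).
Proof.
by split; [rewrite -(rmorph1 (cst F')) pull_cst rmorph1 | exact: pullM].
Qed.

HB.instance Definition _ := GRing.isZmodMorphism.Build F' F (pull u)
  pull_zmod_morphism.
HB.instance Definition _ := GRing.isMonoidMorphism.Build F' F (pull u)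
  pull_monoid_morphism.

End PullMorphism.

Definition pull_point F F' (phi : {rmorphism F' -> F})
    (phi_cst : forall c, phi (cst F' c) = cst F c) (P : point F) : point F'.
Proof.
refine (@Point _ F' (fun f => local_ring P (phi f)) _ _ _ _).
- by move=> c; rewrite phi_cst; apply: local_ring_cst.
- by move=> f g; rewrite rmorphB; apply: local_ringB.
- by move=> f g; rewrite rmorphM; apply: local_ringM.
- by move=> f; rewrite fmorphV; apply: local_ringV.
Defined.

(** Taking preimages of valuation rings along [phi] and [psi] gives mutually inverse maps on
    points. *)
Lemma curve_iso_of_fields F F' (phi : {rmorphism F' -> F}) (psi : {rmorphism F -> F'}) :
  cancel phi psi -> cancel psi phi ->
  (forall c, phi (cst F' c) = cst F c) ->
  exists u : curve_iso F F', pull u =1 phi.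
Proof.
move=> phiK psiK phic.
have psic c : psi (cst F c) = cst F' c by rewrite -phic phiK.
have ptK : cancel (pull_point phic) (pull_point psic).
  by move=> P; apply: point_ext => f; rewrite /= psiK.
have ptVK : cancel (pull_point psic) (pull_point phic).
  by move=> P; apply: point_ext => f; rewrite /= phiK.
by exists (CurveIso ptK ptVK phiK psiK (rmorphD phi) (rmorphM phi) phic
  (fun _ _ => iff_refl _)).
Qed.

End Points.

(** * The quotient by an Artin-Schreier polynomial *)

Section ArtinSchreierQuotient.
Import Pdiv.CommonRing Pdiv.RingMonic.
Variables (K : fieldType) (f : K).

Let P : {poly K} := 'X^2 + 'X - f%:P.

Hypothesis irr : monic_irreducible_poly P.

Let E : fieldType := {poly %/ P with irr}.
Let j : {rmorphism K -> E} := @qpolyC K P.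
Let y : E := 'qX : {poly %/ P}.

Let mk_monicP : mk_monic P = P.
Proof. by rewrite /mk_monic AS_size AS_monic. Qed.

Let reduce : {poly K} -> E := in_qpoly P.

Let reduceM p q : reduce (p * q) = reduce p * reduce q.
Proof. exact: in_qpolyM. Qed.

Let reduceD p q : reduce (p + q) = reduce p + reduce q.
Proof. exact: in_qpolyD. Qed.

Let reduceC c : reduce c%:P = j c.
Proof.
apply: val_inj; rewrite /= rmodp_small // mk_monicP AS_size size_polyC.
by case: eqP.
Qed.

Let reduce_linear u w : reduce (w *: 'X + u%:P) = j u + j w * y.
Proof. by rewrite -mul_polyC reduceD reduceM !reduceC addrC. Qed.

Let size_linear (u w : K) : (size (w *: 'X + u%:P)%R < size P)%N.
Proof.
rewrite AS_size ltnS (leq_trans (size_polyD _ _)) // geq_max size_polyC.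
rewrite (leq_trans (size_scale_leq _ _)) ?size_polyX //.
by case: eqP.
Qed.

Let val_reduce_linear u w : val (reduce (w *: 'X + u%:P) : {poly %/ P}) = w *: 'X + u%:P.
Proof. by rewrite /= mk_monicP rmodp_small. Qed.

Lemma AS_quotient_root : y ^+ 2 + y = j f.
Proof.
have : reduce P = 0 by apply: val_inj; rewrite /= mk_monicP rmodpp // AS_monic.
rewrite {1}/P -polyCN reduceD reduceC rmorphN /= reduceD expr2 reduceM => /eqP.
by rewrite subr_eq0 => /eqP.
Qed.

Lemma AS_quotient_span z : exists u w, z = j u + j w * y.
Proof.
pose p : {poly K} := val (z : {poly %/ P}).
exists p`_0, p`_1; rewrite -reduce_linear; apply: val_inj.
rewrite val_reduce_linear.
have szz : (size p <= 2)%N.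
  rewrite -ltnS; apply: leq_trans (size_mk_monic (z : {poly %/ P})) _.
  by rewrite mk_monicP AS_size.
apply/polyP=> -[|[|n]]; rewrite !coefE /= ?(mulr0, mulr1, addr0, add0r) //.
by rewrite nth_default // (leq_trans szz).
Qed.

Lemma AS_quotient_free u w : j u + j w * y = 0 -> w = 0.
Proof.
rewrite -reduce_linear => /(congr1 val); rewrite val_reduce_linear /=.
by move=> /(congr1 (fun p : {poly _} => p`_1)); rewrite !coefE /= mulr1 addr0.
Qed.

Variables (M : fieldType) (phi : {rmorphism K -> M}) (Y : M).
Hypothesis YE : Y ^+ 2 + Y = phi f.

(** Universal property of the quotient: the reduced representative is evaluated at [Y]. As [P]
    vanishes there, a polynomial and its remainder have the same value, which gives
    multiplicativity. *)
Lemma AS_quotient_lift : exists psi : {rmorphism E -> M},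
  (forall u, psi (j u) = phi u) /\ psi y = Y.
Proof.
pose psi (z : E) := (map_poly phi (val (z : {poly %/ P}))).[Y].
have psi_reduce p : psi (reduce p) = (map_poly phi p).[Y].
  have P0 : (map_poly phi P).[Y] = 0.
    rewrite rmorphB rmorphD /= map_polyXn map_polyX map_polyC.
    by rewrite !(hornerD, hornerN, hornerXn, hornerX, hornerC) YE subrr.
  rewrite /psi /= mk_monicP [in RHS](rdivp_eq (AS_monic f) p).
  by rewrite rmorphD rmorphM /= hornerD hornerM P0 mulr0 add0r.
have psi_zmod : zmod_morphism psi.
  move=> a b; rewrite /psi.
  have -> : val (a - b : {poly %/ P}) =
      val (a : {poly %/ P}) - val (b : {poly %/ P}) by [].
  by rewrite rmorphB hornerD hornerN.
have psi_monoid : monoid_morphism psi.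
  split=> [|a b].
    have -> : 1 = reduce 1 :> E by rewrite -polyC1 reduceC rmorph1.
    by rewrite psi_reduce rmorph1 hornerC.
  have -> : a * b = reduce (val (a : {poly %/ P}) * val (b : {poly %/ P})) by [].
  by rewrite psi_reduce rmorphM hornerM.
pose m1 := GRing.isZmodMorphism.Build _ _ psi psi_zmod.
pose m2 := GRing.isMonoidMorphism.Build _ _ psi psi_monoid.
pose psiR : {rmorphism E -> M} := HB.pack psi m1 m2.
exists psiR; split=> [u|]; rewrite /= -?reduceC /y ?psi_reduce ?map_polyC ?hornerC //.
by rewrite map_polyX hornerX.
Qed.

End ArtinSchreierQuotient.

Section ExtensionMorphisms.
Variables (k : fieldType) (f : ratfun k) (L : fieldType).
Variables (j : {rmorphism ratfun k -> L}) (y : L).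
Hypothesis ext : AS_extension f j y.

Lemma ratfun_rmorphism_ext (M : fieldType) (phi psi : {rmorphism ratfun k -> M}) :
  (forall c, phi c%:P%:F = psi c%:P%:F) -> phi 'X%:F = psi 'X%:F -> phi =1 psi.
Proof.
move=> cE XE u.
have pE (p : {poly k}) : phi p%:F = psi p%:F.
  elim/poly_ind: p => [|p c IH]; first by rewrite !rmorph0.
  rewrite !tofracD !tofracM !(rmorphD phi, rmorphM phi).
  by rewrite !(rmorphD psi, rmorphM psi) IH XE cE.
have [D [N [_ [D0 -> _]]]] := ratfun_common_denominator u 0.
by rewrite !fmorph_div !pE.
Qed.

Lemma AS_rmorphism_ext (M : fieldType) (phi psi : {rmorphism L -> M}) :
  (forall c, phi (j c%:P%:F) = psi (j c%:P%:F)) ->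
  phi (j 'X%:F) = psi (j 'X%:F) -> phi y = psi y -> phi =1 psi.
Proof.
move=> cE XE yE z; have [_ span _] := ext; have [u [w ->]] := span z.
have jE := @ratfun_rmorphism_ext M (phi \o j) (psi \o j) cE XE.
by rewrite !rmorphD !rmorphM yE; congr (_ + _ * _); apply: jE.
Qed.

(** It suffices to compare on k, x and y. Both maps translate by the same [c], since c + c = 0. *)
Lemma AS_twist_cancel (M : fieldType) (i : {rmorphism ratfun k -> M}) (t : M)
    (phi : {rmorphism L -> M}) (psi : {rmorphism M -> L}) (e e' c : k) :
  2%:R = 0 :> k -> e * e' = 1 ->
  (forall a, phi (j a%:P%:F) = i a%:P%:F) ->
  (forall a, psi (i a%:P%:F) = j a%:P%:F) ->
  phi (j 'X%:F) = i (e *: 'X)%:F -> psi (i 'X%:F) = j (e' *: 'X)%:F ->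
  phi y = t + i c%:P%:F -> psi t = y + j c%:P%:F -> cancel phi psi.
Proof.
move=> two ee' phic psic phiX psiX phiy psiy.
apply: (@AS_rmorphism_ext _ (psi \o phi) idfun) => [a||] /=.
- by rewrite phic psic.
- rewrite phiX -mul_polyC tofracM 2!rmorphM psic psiX -mul_polyC tofracM rmorphM.
  by rewrite mulrA -rmorphM -tofracM -polyCM ee' polyC1 tofrac1 rmorph1 mul1r.
- rewrite phiy rmorphD psiy psic -addrA -rmorphD -tofracD -polyCD.
  by rewrite -mulr2n -mulr_natl two mul0r polyC0 tofrac0 rmorph0 addr0.
Qed.
End ExtensionMorphisms.

Section Scaling.
Variable k : fieldType.
Implicit Types (e : k) (p : {poly k}) (u : ratfun k).

Definition scaling_poly e : {rmorphism {poly k} -> ratfun k} :=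
  @FracField.tofrac {poly k} \o comp_poly (e *: 'X).

Lemma scaling_exists e : e != 0 -> exists phi : {rmorphism ratfun k -> ratfun k},
  forall p, phi p%:F = (p \Po (e *: 'X))%:F.
Proof.
move=> e0.
have inj p : scaling_poly e p = 0 -> p = 0.
  move=> /eqP; rewrite /= tofrac_eq0 comp_poly2_eq0 => [/eqP //|].
  by rewrite size_scale // size_polyX.
exact: ratfun_rmorphism_of_poly inj.
Qed.
End Scaling.

(** * Isomorphisms between the curves of the family *)

Section Curves.
Variables (k : fieldType) (s : k).
Hypothesis two : 2%:R = 0 :> k.
Hypothesis s_irr : irreducible_poly ('X^3 + s%:P).
Implicit Types (v : coefs k) (d e c : k).

Let oppk (x : k) : - x = x.
Proof. by apply/eqP; rewrite eq_sym -addr_eq0 -mulr2n -mulr_natl two mul0r. Qed.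

Lemma curve_extension v d :
  AS_extension (AS_rhs s (val v) d) (AS_ratfun s_irr v d) (fun_y s_irr v d).
Proof.
split; first exact: AS_quotient_root.
  exact: AS_quotient_span.
exact: AS_quotient_free.
Qed.

(** The element y' + c solves the equation of [y] after x -> e x: the cubic is unchanged because e^3
    = 1, and c^2 + c makes up for d - d'. *)
Lemma twist_rmorphism v v' d d' e c :
  e ^+ 3 = 1 -> val v' = twist e (val v) -> d - d' = c + c ^+ 2 ->
  exists phi : {rmorphism curveC s_irr v d -> curveC s_irr v' d'},
  [/\ forall a : k, phi (AS_ratfun s_irr v d a%:P%:F) = AS_ratfun s_irr v' d' a%:P%:F,
      phi (AS_ratfun s_irr v d 'X%:F) = AS_ratfun s_irr v' d' (e *: 'X)%:F
    & phi (fun_y s_irr v d) = fun_y s_irr v' d' + AS_ratfun s_irr v' d' c%:P%:F].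
Proof.
move=> e3 vE dE.
have e0 : e != 0 by apply: contra_eq_neq e3 => ->; rewrite expr0n eq_sym oner_eq0.
have [sc scE] := scaling_exists e0.
set j := AS_ratfun s_irr v d; set j' := AS_ratfun s_irr v' d'.
pose Y := fun_y s_irr v' d' + j' c%:P%:F.
have YE : Y ^+ 2 + Y = (j' \o sc) (AS_rhs s (val v) d).
  have [y2 _ _] := curve_extension v' d'.
  have twoL := two_ext j' two.
  rewrite /Y sqrrD -[_ *+ 2]mulr_natl twoL mul0r addr0 addrACA.
  rewrite y2 -rmorphXn -rmorphD -rmorphD /=; congr (j' _).
  rewrite !AS_rhsE vE numer_twist [in RHS](rmorphD sc) fmorph_div !scE.
  have -> : ('X^3 + s%:P) \Po (e *: 'X) = 'X^3 + s%:P.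
    by rewrite comp_polyD comp_Xn_poly comp_polyC exprZn e3 scale1r.
  rewrite comp_polyC -addrA.
  congr (_ + _); rewrite -tofracXn -!tofracD -polyC_exp -!polyCD; congr (_%:P%:F).
  by rewrite [c ^+ 2 + c]addrC -dE addrC subrK.
have [phi [phij phiy]] := AS_quotient_lift
  (AS_poly_irreducible d s_irr (valP v)) YE.
exists phi; split; [| |exact: phiy].
  by move=> a; rewrite [LHS]phij /= scE comp_polyC.
by rewrite [LHS]phij /= scE comp_polyX.
Qed.

Lemma twist_curve_iso v v' d d' e c :
  e ^+ 3 = 1 -> val v' = twist e (val v) -> d - d' = c + c ^+ 2 ->
  exists u : curve_iso (curveC s_irr v' d') (curveC s_irr v d),
  pull u (AS_ratfun s_irr v d 'X%:F) = AS_ratfun s_irr v' d' (e *: 'X)%:F /\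
  pull u (fun_y s_irr v d) = fun_y s_irr v' d' + AS_ratfun s_irr v' d' c%:P%:F.
Proof.
move=> e3 vE dE.
have e0 : e != 0 by apply: contra_eq_neq e3 => ->; rewrite expr0n eq_sym oner_eq0.
have [phi [phic phiX phiy]] := twist_rmorphism e3 vE dE.
have e3' : e^-1 ^+ 3 = 1 by rewrite exprVn e3 invr1.
have vE' : val v = twist e^-1 (val v').
  have e2 : e^-1 ^+ 2 * e ^+ 2 = 1 by rewrite -exprMn mulVf // expr1n.
  rewrite vE /twist /= [_ * (e ^+ 2 * _)]mulrA e2 mulKf // mul1r.
  by case: (val v) => -[].
have dE' : d' - d = c + c ^+ 2 by rewrite -opprB dE oppk.
have [psi [psic psiX psiy]] := twist_rmorphism e3' vE' dE'.
have phiK : cancel phi psi.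
  exact: (AS_twist_cancel (curve_extension v d) two (mulfV e0) phic psic
    phiX psiX phiy psiy).
have psiK : cancel psi phi.
  exact: (AS_twist_cancel (curve_extension v' d') two (mulVf e0) psic phic
    psiX phiX psiy phiy).
have [u uE] := curve_iso_of_fields phiK psiK phic.
exists u; split; [exact: etrans (uE _) phiX | exact: etrans (uE _) phiy].
Qed.

Lemma curve_iso_rigidity v v' d d'
    (u : curve_iso (curveC s_irr v' d') (curveC s_irr v d)) :
  exists e r, [/\ e ^+ 3 = 1,
    pull u (AS_ratfun s_irr v d 'X%:F) = AS_ratfun s_irr v' d' (e *: 'X)%:F,
    pull u (fun_y s_irr v d) = fun_y s_irr v' d' + AS_ratfun s_irr v' d' r,
    val v' = twist e (val v) & r ^+ 2 + r = (d - d')%:P%:F].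
Proof.
pose sigma : {rmorphism curveC s_irr v d -> curveC s_irr v' d'} := pull u.
pose tau : {rmorphism curveC s_irr v' d' -> curveC s_irr v d} := pull (curve_inv u).
have [e [r [e3 XE yE vE rE]]] := AS_isomorphism_rigidity two s_irr (valP v)
  (valP v') (curve_extension v d) (curve_extension v' d')
  (sigma := sigma) (tau := tau) (pullK u) (pullVK u) (pull_cst u).
by exists e, r; split; [exact: e3|exact: XE|exact: yE|exact: vE|exact: rE].
Qed.

Lemma AS_const d r : r ^+ 2 + r = d%:P%:F -> exists c, d = c + c ^+ 2.
Proof.
move=> rE; have [||] := @AS_regular k _ s_irr two 0 d r.
- by rewrite size_poly0 size_h.
- by rewrite tofrac0 mul0r add0r.
by [].
Qed.

Lemma curve_iso_eqP v v' d d'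
    (u w : curve_iso (curveC s_irr v' d') (curveC s_irr v d)) :
  pull u (AS_ratfun s_irr v d 'X%:F) = pull w (AS_ratfun s_irr v d 'X%:F) ->
  pull u (fun_y s_irr v d) = pull w (fun_y s_irr v d) -> u = w.
Proof.
move=> XE yE; apply: curve_iso_ext.
pose phi : {rmorphism curveC s_irr v d -> curveC s_irr v' d'} := pull u.
pose psi : {rmorphism curveC s_irr v d -> curveC s_irr v' d'} := pull w.
exact: (AS_rmorphism_ext (curve_extension v d) (phi := phi) (psi := psi)
  (fun c => etrans (pull_cst u c) (esym (pull_cst w c))) XE yE).
Qed.

End Curves.

(** * Isotropy groups *)

Section Isotropy.
Variables (k : fieldType) (char2 : 2%N \in [pchar k]) (n : Npar char2).

Lemma val_act (g : Gamma k) : val (act n g).1 = twist (eps g) (val n.1).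
Proof. by []. Qed.

Lemma isotropyP (g : Gamma k) :
  reflect (val n.1 = twist (eps g) (val n.1)) (in_isotropy n g).
Proof.
apply: (iffP eqP) => [gn|gn]; first by rewrite -val_act gn.
case: n gn => v q /= gn; congr pair; exact/val_inj/esym.
Qed.

(** If b is nonzero, e b = b gives e = 1; otherwise a is nonzero and e^2 = 1, which together with
    e^3 = 1 gives e = 1. *)
Lemma isotropy_trivial : (val n.1).1 <> (0, 0) -> forall g : isotropy n, g = 1%g.
Proof.
move=> ab0 [g gn]; apply/val_inj/val_inj => /=.
move/isotropyP: (gn); case: (val n.1) ab0 => [[a b] c] /= ab0 [aE bE].
have e3 := epsP g; have [b0|b0] := eqVneq b 0; last first.
  by apply: (mulIf b0); rewrite mul1r -bE.
have a0 : a != 0 by apply: contra_notN ab0 => /eqP ->; rewrite b0.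
have e2 : eps g ^+ 2 = 1 by apply: (mulIf a0); rewrite mul1r -aE.
by rewrite -[LHS]mul1r -e2 -exprSr e3.
Qed.

(** An element of the field of order 4 other than 0 and 1 satisfies x^4 = x, hence x^3 = 1. *)
Lemma contains_F4_cube_root : contains_F4 k -> exists2 w : k, w ^+ 3 = 1 & w != 1.
Proof.
case=> F [i F4].
have [x x01] : exists x : F, x \notin [set 0; 1 : F].
  apply/existsP; rewrite -negb_forall; apply/negP => /forallP F01.
  have : (#|F| <= #|[set 0; 1 : F]%R|)%N by apply/subset_leq_card/subsetP => x _.
  by rewrite F4 cards2; case: (_ != _).
have [x0 x1] : x != 0 /\ x != 1 by move: x01; rewrite !inE negb_or => /andP.
exists (i x); last by rewrite -(rmorph1 i) (inj_eq (fmorph_inj i)).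
rewrite -rmorphXn (_ : x ^+ 3 = 1) ?rmorph1 //.
by apply: (mulIf x0); rewrite -exprSr -F4 expf_card mul1r.
Qed.

(** The isomorphism is the discrete logarithm to the base of a primitive cube root of unity [w]. *)
Lemma isotropy_cyclic3 : contains_F4 k -> (val n.1).1 = (0, 0) ->
  exists f : {multiplicative isotropy n -> 'Z_3}, bijective f.
Proof.
move=> /contains_F4_cube_root[w w3 w1] ab0.
have w0 : w != 0 by apply: contra_eq_neq w3 => ->; rewrite expr0n eq_sym oner_eq0.
have w21 : w ^+ 2 != 1.
  by apply: contra w1 => /eqP w2; rewrite -w3 exprS w2 mulr1.
have w2w : w ^+ 2 != w by rewrite expr2 -{3}[w]mulr1 (inj_eq (mulfI w0)).
have inj (a b : 'I_3) : w ^+ a = w ^+ b -> a = b.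
  have distinct := (negPf w1, negPf w21, negPf w2w).
  have := (distinct, etrans (eq_sym 1 w) (negPf w1),
    etrans (eq_sym 1 _) (negPf w21), etrans (eq_sym w _) (negPf w2w)).
  move=> neq E; apply: val_inj; move: E.
  by case: a b => [[|[|[|//]]] _] [[|[|[|//]]] _] //= /eqP;
    rewrite ?expr0 ?expr1 neq.
have root3 (g : Gamma k) : exists a : 'Z_3, eps g = w ^+ (a : nat).
  (* The factorization of T^3 - 1, which rests on w^2 + w + 1 = 0. *)
  have : (eps g - 1) * ((eps g - w) * (eps g - w ^+ 2)) == 0.
    have S0 : w ^+ 2 + w + 1 = 0.
      apply: (mulfI (_ : w - 1 != 0)); first by rewrite subr_eq0.
      have -> : (w - 1) * (w ^+ 2 + w + 1) = w ^+ 3 - 1 by ring.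
      by rewrite w3 subrr mulr0.
    have -> : (eps g - 1) * ((eps g - w) * (eps g - w ^+ 2)) =
        (eps g ^+ 3 - 1) - (eps g - 1) * eps g * (w ^+ 2 + w + 1)
        + (eps g - 1) * (w ^+ 3 - 1) by ring.
    by rewrite S0 w3 epsP !subrr !mulr0 subrr addr0.
  rewrite !mulf_eq0 !subr_eq0 => /or3P[]/eqP->.
  - by exists 0.
  - by exists 1; rewrite expr1.
  - by exists (inZp 2).
have iso_all (g : Gamma k) : in_isotropy n g.
  apply/isotropyP; move: ab0; case: (val n.1) => [[a b] c] /= [-> ->].
  by rewrite /twist /= !mulr0.
pose f (g : isotropy n) : 'Z_3 := projT1 (cid (root3 (val g))).
have fE g : eps (val g) = w ^+ (f g : nat) by rewrite /f; case: cid.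
have f_mul : {morph f : x y / (x * y)%g}.
  move=> x y; apply: inj; rewrite -fE /= !fE -exprD.
  by rewrite -(expr_mod (f x + f y)%N w3).
pose m := isMultiplicative.Build _ _ f f_mul.
pose fM : {multiplicative isotropy n -> 'Z_3} := HB.pack f m.
exists fM.
have power3 (a : 'Z_3) : (w ^+ (a : nat)) ^+ 3 == 1 by rewrite exprAC w3 expr1n.
pose h (a : 'Z_3) : isotropy n := Isotropy (iso_all (GammaOf (power3 a))).
exists h => [g|a].
  by apply/val_inj/val_inj; rewrite /= -fE.
by apply: inj; rewrite -fE.
Qed.

End Isotropy.

(** * Automorphisms as scalings and translations *)

Section Automorphisms.
Variables (k : fieldType) (char2 : 2%N \in [pchar k]) (s : k).
Hypothesis s_irr : irreducible_poly ('X^3 + s%:P).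

Let two : 2%:R = 0 :> k := pcharf0 char2.

Lemma pi_AS_eqP (d d' : k) :
  (\pi_(Quotient.quot (AS char2)) d = \pi d') <-> exists c, d - d' = c + c ^+ 2.
Proof.
rewrite (rwP eqP) -Quotient.idealrBE.
by split=> [/asboolP|H]; last exact/asboolP.
Qed.

Lemma k_isomorphicP (n n' : Npar char2) (d d' : k) :
  n.2 = \pi d -> n'.2 = \pi d' ->
  k_isomorphic (curveC s_irr n'.1 d') (curveC s_irr n.1 d) <->
  exists g : Gamma k, n' = act n g.
Proof.
move=> nd n'd'; split=> [[u]|[g n'E]].
  have [e [r [e3 _ _ vE rE]]] := curve_iso_rigidity two u.
  have e3b : e ^+ 3 == 1 by rewrite e3.
  exists (GammaOf e3b); have [c dE] := AS_const two s_irr rE.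
  case: n n' nd n'd' vE {u} => [v q] [v' q'] /= nd n'd' vE.
  congr pair; first exact: val_inj.
  by rewrite n'd' /= nd; apply/esym/pi_AS_eqP; exists c.
have vE : val n'.1 = twist (eps g) (val n.1) by rewrite n'E.
have /pi_AS_eqP[c dE] : \pi_(Quotient.quot (AS char2)) d = \pi d'.
  by rewrite -nd -n'd' n'E.
have [u _] := twist_curve_iso two s_irr (epsP g) vE dE.
exact: inhabits u.
Qed.

Variables (n : Npar char2) (d : k).

Let C := curveC s_irr n.1 d.
Let j := AS_ratfun s_irr n.1 d.
Let y := fun_y s_irr n.1 d.

Definition aut_cst (u : curve_aut C) (g : isotropy n) (c : k) : Prop :=
  aut_form u (Gamma_ratfun (val g)) c%:P%:F.

(** For an automorphism d' = d, so the translation part [r] satisfies r^2 + r = 0. *)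
Lemma aut_cstP (u : curve_aut C) : exists g c, aut_cst u g c /\ (c = 0 \/ c = 1).
Proof.
have [e [r [e3 XE yE vE rE]]] := curve_iso_rigidity two u.
have e3b : e ^+ 3 == 1 by rewrite e3.
have gn : in_isotropy n (GammaOf e3b) by apply/isotropyP.
have : r * (r + 1) == 0.
  by rewrite mulrDr mulr1 -expr2 rE subrr polyC0 tofrac0 eqxx.
rewrite mulf_eq0 addr_eq0 => r01.
have rc : exists2 c, r = c%:P%:F & c = 0 \/ c = 1.
  case/orP: r01 => /eqP ->; first by exists 0; [rewrite polyC0 tofrac0|left].
  exists 1; last by right.
  apply/eqP; rewrite polyC1 tofrac1 eq_sym -addr_eq0 -mulr2n -mulr_natl.
  by rewrite two_ratfun // mul0r.
have [c rE' c01] := rc; rewrite rE' in yE.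
by exists (Isotropy gn), c; split; first by split; [exact: XE | exact: yE].
Qed.

Lemma aut_cst_inj (u : curve_aut C) g h c c' :
  aut_cst u g c -> aut_cst u h c' -> g = h.
Proof.
move=> [gE _] [hE _]; apply/val_inj/val_inj.
have /fmorph_inj/eqP : j (Gamma_ratfun (val g)) = j (Gamma_ratfun (val h)).
  exact: etrans (esym gE) hE.
rewrite tofrac_eq => /eqP/(congr1 (fun p : {poly k} => p`_1)).
by rewrite !coefZ coefX !mulr1.
Qed.

Lemma aut_cst_eq (u u' : curve_aut C) g c :
  aut_cst u g c -> aut_cst u' g c -> u = u'.
Proof.
move=> [uX uy] [u'X u'y].
exact: (curve_iso_eqP (etrans uX (esym u'X)) (etrans uy (esym u'y))).
Qed.

(** Constants are fixed by [pull u'], so scalings multiply and translations add. *)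
Lemma aut_cstM (u u' : curve_aut C) g g' c c' :
  aut_cst u g c -> aut_cst u' g' c' -> aut_cst (u * u')%g (g * g')%g (c + c').
Proof.
move=> [uX uy] [u'X u'y].
pose phi : {rmorphism C -> C} := pull u'.
have phic a : phi (j a%:P%:F) = j a%:P%:F by exact: (pull_cst u' a).
split.
  apply: (etrans (congr1 phi uX)).
  rewrite /Gamma_ratfun -mul_polyC tofracM 2!rmorphM [phi (j _%:P%:F)]phic.
  rewrite [phi (j 'X%:F)]u'X -rmorphM -tofracM /= mul_polyC scalerA; exact: erefl.
apply: (etrans (congr1 phi uy)).
rewrite rmorphD [phi (j _%:P%:F)]phic [phi y]u'y -addrA -rmorphD -tofracD -polyCD.
by rewrite [c' + c]addrC.
Qed.

Lemma aut_cst_exists g c : c + c ^+ 2 = 0 -> exists u, aut_cst u g c.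
Proof.
move=> c0; have /isotropyP gn := valP g.
have dE : d - d = c + c ^+ 2 by rewrite subrr c0.
have [u [uX uy]] := twist_curve_iso two s_irr (epsP (val g)) gn dE.
by exists u; split; [exact: uX | exact: uy].
Qed.

End Automorphisms.

(** * The split exact sequence *)

Section SplitExactSequence.
Variables (k : fieldType) (char2 : 2%N \in [pchar k]) (s : k).
Hypothesis s_irr : irreducible_poly ('X^3 + s%:P).
Variables (n : Npar char2) (d : k).

Let C := curveC s_irr n.1 d.
Let two : 2%:R = 0 :> k := pcharf0 char2.

Lemma aut_cst1 : aut_cst (1%g : curve_aut C) 1%g 0.
Proof.
split; first by rewrite /Gamma_ratfun scale1r.
by rewrite polyC0 tofrac0 rmorph0 addr0.
Qed.

(** [rho] reads off the scaling. Its kernel consists of the translations by 0 and 1, that is, of the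
    identity and [iota]; the lifts with translation part 0 form the section. *)
Lemma aut_split_exact :
  exists (iota : curve_aut C) (rho : {multiplicative curve_aut C -> isotropy n}),
  [/\ aut_form iota (ratfun_x k) 1,
      forall phi, exists w, aut_form phi (Gamma_ratfun (val (rho phi))) w
    & split_exact (cyclic_subgroup iota) rho].
Proof.
have [iota iotaE] : exists iota : curve_aut C, aut_cst iota 1%g 1.
  by apply: aut_cst_exists; rewrite expr1n.
pose f (u : curve_aut C) := projT1 (cid (aut_cstP u)).
have fE u : exists2 c, aut_cst u (f u) c & c = 0 \/ c = 1.
  by rewrite /f; case: cid => g /= [c [uE c01]]; exists c.
have f_mul : {morph f : u u' / (u * u')%g}.
  move=> u u'; have [c uE _] := fE u; have [c' u'E _] := fE u'.
  have [c'' uu'E _] := fE (u * u')%g.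
  exact: aut_cst_inj uu'E (aut_cstM uE u'E).
have f_eq u g c : aut_cst u g c -> f u = g.
  by move=> uE; have [c' uE' _] := fE u; exact: aut_cst_inj uE' uE.
pose f_mixin := isMultiplicative.Build _ _ f f_mul.
pose rho : {multiplicative curve_aut C -> isotropy n} := HB.pack f f_mixin.
have f1 : f 1%g = 1%g by exact: f_eq aut_cst1.
pose f1_mixin := Multiplicative_isUMagmaMorphism.Build _ _ f f1.
(* The same map, now also known to preserve 1, so that it commutes with powers and inverses. *)
pose rho1 : UMagmaMorphism.type (curve_aut C) (isotropy n) :=
  HB.pack f f_mixin f1_mixin.
have zero : 0 + 0 ^+ 2 = 0 :> k by rewrite expr0n addr0.
pose h (g : isotropy n) : curve_aut C := projT1 (cid (aut_cst_exists s_irr d g zero)).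
have hE g : aut_cst (h g) g 0 by rewrite /h; case: cid.
have h_mul : {morph h : g g' / (g * g')%g}.
  move=> g g'; apply: aut_cst_eq (hE _) _; rewrite -[0]addr0.
  exact: aut_cstM (hE g) (hE g').
pose h_mixin := isMultiplicative.Build _ _ h h_mul.
pose sec : {multiplicative isotropy n -> curve_aut C} := HB.pack h h_mixin.
have secK : cancel sec rho by move=> g; apply: f_eq (hE g).
exists iota, rho; split.
- have [iotaX iotay] := iotaE; split.
    by move: iotaX; rewrite /Gamma_ratfun scale1r.
  by move: iotay; rewrite polyC1 tofrac1.
- by move=> u; have [c uE _] := fE u; exists c%:P%:F.
split; last by exists sec.
- have rho_iota m : rho1 (iota ^+ m)%g = 1%g.
    by rewrite gmulfXn [rho1 iota](f_eq _ _ _ iotaE) expg1n.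
  move=> u; split=> [[m []->]|fu].
  + exact: rho_iota.
  + by rewrite [LHS](gmulfV rho1) rho_iota invg1.
  have [c] := fE u; rewrite [f u]fu => uE [c0|c1].
    by exists 0; left; rewrite c0 in uE; apply: aut_cst_eq uE aut_cst1.
  by exists 1; left; rewrite c1 in uE; rewrite expg1; apply: aut_cst_eq uE iotaE.
- by move=> g; exists (sec g).
Qed.

End SplitExactSequence.

Unset Implicit Arguments.

Theorem proposition13 (k : fieldType) (char2 : 2%N \in [pchar k])
    (k_perfect : perfect_field k) (k_F4 : contains_F4 k)
    (s : k) (s_irr : irreducible_poly ('X^3 + s%:P)) :
  (forall (n n' : Npar char2) (d d' : k), n.2 = \pi d -> n'.2 = \pi d' ->
     k_isomorphic (curveC s_irr n'.1 d') (curveC s_irr n.1 d) <->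
     exists g : Gamma k, n' = act n g)
  /\
  (forall (n : Npar char2) (d : k), n.2 = \pi d ->
     [/\ exists (iota : curve_aut (curveC s_irr n.1 d))
                (rho : {multiplicative curve_aut (curveC s_irr n.1 d) -> isotropy n}),
           [/\ aut_form iota (ratfun_x k) 1,
               forall phi, exists w, aut_form phi (Gamma_ratfun (val (rho phi))) w
             & split_exact (cyclic_subgroup iota) rho],
         (val n.1).1 = (0, 0) ->
           exists f : {multiplicative isotropy n -> 'Z_3}, bijective f
       & (val n.1).1 <> (0, 0) ->
           forall g : isotropy n, g = 1%g]).
Proof.
split=> [n n' d d' nd n'd'|n d _]; first exact: k_isomorphicP.
split; [exact: aut_split_exact | exact: isotropy_cyclic3 | exact: isotropy_trivial].
Qed.
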